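(* Let $T>0$, let $(U,d_U)$ be a compact metric space, and let $f:\mathbb{R}^d\times U\to\mathbb{R}^d$ satisfy: (i) $f$ is continuous and there exists $m>0$ such that $|f(x,u)|\le m(1+|x|)$ for all $(x,u)\in\mathbb{R}^d\times U$; (ii) for each compact set $K\subset\mathbb{R}^d$ there exists $\ell_K>0$ such that $|f(x,u)-f(y,u)|\le \ell_K|x-y|$ for all $x,y\in K$ and $u\in U$. Let $\mathcal{K}_{(\tau,t)}$ and $\mathcal{L}$ be the associated set-valued Koopman and Liouville operators, and fix $\tau\in[0,T]$. Then the inclusions $$\mathcal{L}(\varphi)\subset\operatorname*{Liminf}_{t\to\tau}\frac{\mathcal{K}_{(\tau,t)}(\varphi)-\varphi}{t-\tau}\qquad\text{and}\qquad \operatorname*{Limsup}_{t\to\tau}\frac{\mathcal{K}_{(\tau,t)}(\varphi)-\varphi}{t-\tau}\subset\overline{\mathrm{co}}\,\mathcal{L}(\varphi)$$ hold for each $\varphi\in\mathcal{D}$. Furthermore, if the set of controlled vector fields $\mathcal{F}:=\{f_u=f(\cdot,u)\in C^0(\mathbb{R}^d,\mathbb{R}^d)~:~u\in U\}$ is convex, then the set-valued Liouville operator $\mathcal{L}:\mathcal{D}\rightrightarrows\mathcal{X}$ is the infinitesimal generator of the Koopman semigroup, in the sense that $$\mathcal{L}(\varphi)=\operatorname*{Lim}_{t\to\tau}\frac{\mathcal{K}_{(\tau,t)}(\varphi)-\varphi}{t-\tau}$$ for each $\varphi\in\mathcal{D}$.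
   Context: $\mathcal{X}:=C^0_c(\mathbb{R}^d,\mathbb{C})$ with the supremum norm and $\mathcal{D}:=C^1_c(\mathbb{R}^d,\mathbb{C})$. $\mathcal{U}$ is the set of Lebesgue-measurable maps $u:[0,T]\to U$. For $u(\cdot)\in\mathcal{U}$, the controlled flow $(\Phi^u_{(\tau,t)})_{\tau,t\in[0,T]}\subset C^0(\mathbb{R}^d,\mathbb{R}^d)$ is the unique solution of $\Phi^u_{(\tau,t)}(x)=x+\int_\tau^t f(\Phi^u_{(\tau,s)}(x),u(s))\,ds$ for all $\tau,t\in[0,T]$, $x\in\mathbb{R}^d$. The set-valued Koopman operators are $\mathcal{K}_{(\tau,t)}(\varphi):=\{\varphi\circ\Phi^u_{(\tau,t)}~:~u(\cdot)\in\mathcal{U}\}\subset\mathcal{X}$ for $\varphi\in\mathcal{X}$, and the set-valued Liouville operator is $\mathcal{L}(\varphi):=\{\nabla_x\varphi\cdot f_u~:~u\in U\}\subset\mathcal{X}$ for $\varphi\in\mathcal{D}$. $\overline{\mathrm{co}}$ denotes the closed convex hull in $\mathcal{X}$. For a set $A\subset\mathcal{X}$, $\frac{A-\varphi}{t-\tau}:=\{\frac{\psi-\varphi}{t-\tau}~:~\psi\in A\}$. Kuratowski-Painlevé limits: for a family of sets $(K_t)\subset\mathcal{X}$ indexed by $t\in[0,T]\setminus\{\tau\}$, with $\mathrm{dist}_{\mathcal{X}}(x;K):=\inf_{y\in K}\|x-y\|_{\mathcal{X}}$, $$\operatorname*{Liminf}_{t\to\tau}K_t:=\{x~:~\lim_{t\to\tau}\mathrm{dist}_{\mathcal{X}}(x;K_t)=0\},\qquad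 \operatorname*{Limsup}_{t\to\tau}K_t:=\{x~:~\liminf_{t\to\tau}\mathrm{dist}_{\mathcal{X}}(x;K_t)=0\},$$ and $\operatorname{Lim}_{t\to\tau}K_t$ is their common value when they coincide. *)

(* Defs.v *)
From HB Require Import structures.
From mathcomp Require Import all_boot all_order all_algebra.
From mathcomp Require Import complex.
From mathcomp Require Import all_classical all_reals all_analysis.

Set Implicit Arguments.
Unset Strict Implicit.
Unset Printing Implicit Defensive.

Import Order.TTheory GRing.Theory Num.Theory.
Import numFieldNormedType.Exports.

Local Open Scope classical_set_scope.
Local Open Scope ring_scope.

(* [Rcomplex R] is R[i] seen as a vector space over R, normed by the modulus. *)
HB.instance Definition _ (R : realType) :=
  PseudoMetric.copy (Rcomplex R) (pseudoMetric_normed (Rcomplex R)).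
HB.instance Definition _ (R : realType) := isPointed.Build (Rcomplex R) 0.
HB.instance Definition _ (R : realType) :=
  NormedZmod_PseudoMetric_eq.Build R (Rcomplex R) erefl.

Lemma Rcomplex_normrZ (R : realType) (l : R) (x : Rcomplex R) :
  `|l *: x| = `|l| * `|x|.
Proof.
case: x => a b; rewrite /GRing.scale/= /Num.norm/= !exprMn -mulrDr.
by rewrite sqrtrM ?sqr_ge0// sqrtr_sqr.
Qed.

HB.instance Definition _ (R : realType) :=
  PseudoMetricNormedZmod_Lmodule_isNormedModule.Build R (Rcomplex R)
    (@Rcomplex_normrZ R).


Section continuous_compact_support.
Variables (R : realType) (d : nat).
Implicit Types g h : 'rV[R]_d -> Rcomplex R.

Definition cont_compact_support : {pred 'rV[R]_d -> Rcomplex R} :=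
  [pred g | `[< continuous g /\ compact (closure [set x | g x != 0]) >]].

Lemma cont_compact_supportP g :
  reflect (continuous g /\ compact (closure [set x | g x != 0]))
          (g \in cont_compact_support).
Proof. exact: asboolP. Qed.

Lemma cont_compact_support_submod : submod_closed cont_compact_support.
Proof.
split=> [|a g h /cont_compact_supportP[cg kg] /cont_compact_supportP[ch kh]].
  apply/cont_compact_supportP; split; first exact: (@cst_continuous _ _ (0 : Rcomplex R)).
  rewrite (_ : [set x | _] = set0) ?closure0; first exact: compact0.
  by apply/seteqP; split => x //=; move/eqP; apply.
apply/cont_compact_supportP; split.
  by move=> x; apply: cvgD (ch x); exact: cvgZ (cvg_cst a) (cg x).
apply: subclosed_compact (compactU kg kh) _; first exact: closed_closure.
rewrite -closureU; apply: closure_subset => x /=.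
rewrite /GRing.add/= /GRing.scale/=.
have [g0|gx] := eqVneq (g x) 0; last by left.
have [h0|hx] := eqVneq (h x) 0; last by right.
by rewrite g0 h0 scaler0 addr0 eqxx.
Qed.

HB.instance Definition _ :=
  GRing.isSubmodClosed.Build _ _ cont_compact_support cont_compact_support_submod.

Record Cc := MkCc { Cc_fun :> 'rV[R]_d -> Rcomplex R ;
                    _ : Cc_fun \in cont_compact_support }.

HB.instance Definition _ := [isSub for Cc_fun].
HB.instance Definition _ := [Choice of Cc by <:].
HB.instance Definition _ := [SubChoice_isSubLmodule of Cc by <:].

Definition supnorm (g : Cc) : R := sup [set `|g x| | x in [set: 'rV[R]_d]].

Lemma Cc_bounded (g : Cc) : has_sup [set `|g x| | x in [set: 'rV[R]_d]].
Proof.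
split; first by exists `|g 0|; exists 0.
have /cont_compact_supportP[cg kg] := valP g.
have cng : {within closure [set x | g x != 0], continuous g}.
  exact: continuous_subspaceT.
have /compact_bounded[M [_ /(_ (Num.max M 0 + 1))]] := continuous_compact cng kg.
rewrite ltr_pwDr ?le_max ?lexx// => /(_ isT) gM.
exists (Num.max M 0 + 1) => _ [x _ <-].
have [->|gx] := eqVneq (g x) 0.
  by rewrite normr0 addr_ge0// le_max lexx orbT.
by apply: gM; exists x => //; exact: subset_closure.
Qed.

Lemma supnorm_ub (g : Cc) x : `|g x| <= supnorm g.
Proof. by apply: (sup_upper_bound (Cc_bounded g)); exists x. Qed.

Lemma supnorm_le (g : Cc) r : (forall x, `|g x| <= r) -> supnorm g <= r.
Proof.
move=> gr; apply: ge_sup; first by case: (Cc_bounded g).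
by move=> _ [x _ <-].
Qed.

Lemma supnormD (g h : Cc) : supnorm (g + h) <= supnorm g + supnorm h.
Proof.
apply: supnorm_le => x; apply: le_trans (ler_normD _ _) _.
by apply: lerD; exact: supnorm_ub.
Qed.

Lemma supnormZ (a : R) (g : Cc) : supnorm (a *: g) = `|a| * supnorm g.
Proof.
have le (b : R) (h : Cc) : supnorm (b *: h) <= `|b| * supnorm h.
  apply: supnorm_le => x; rewrite [X in `|X|](_ : _ = b *: h x)//.
  by rewrite normrZ ler_wpM2l// supnorm_ub.
apply/le_anti; rewrite le/=; have [->|a0] := eqVneq a 0.
  by rewrite normr0 mul0r (le_trans _ (supnorm_ub _ 0)).
rewrite -ler_pdivlMl ?normr_gt0// -normfV.
by apply: le_trans (le _ _); rewrite scalerA mulVf// scale1r.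
Qed.

Lemma supnorm_eq0 (g : Cc) : supnorm g = 0 -> g = 0.
Proof.
move=> g0; apply/val_inj/funext => x; apply/eqP.
by rewrite -normr_le0 -g0 supnorm_ub.
Qed.

HB.instance Definition _ :=
  Lmodule_isNormed.Build R Cc supnormD supnormZ supnorm_eq0.

End continuous_compact_support.

Section Euclidean.
Variables (R : realType) (d : nat).

(* The library norm on ['rV[R]_d] is the max norm. *)
Definition enorm (x : 'rV[R]_d) : R := Num.sqrt (\sum_(i < d) x ord0 i ^+ 2).

Definition partial (g : 'rV[R]_d -> Rcomplex R) (i : 'I_d) (x : 'rV[R]_d) :
  Rcomplex R := 'D_(delta_mx ord0 i) g x.

Definition C1c : set (Cc R d) :=
  [set phi | (forall x, differentiable phi x) /\
             (forall i, continuous (partial phi i))].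

End Euclidean.

(* The sigma-algebra of [completed_lebesgue_measure] is the one of
   Lebesgue-measurable sets (the library [lebesgue_measure] is Borel). *)
Definition lebesgue_measurable (R : realType) : set (set R) :=
  (wlength (@idfun R))^*%mu.-cara.-measurable.

(* \int_a^b g(s) ds, with the usual sign when b < a *)
Definition oriented_integral (R : realType) (a b : R) (g : R -> R) : R :=
  if a <= b then \int[@completed_lebesgue_measure R]_(s in `[a, b]) g s
  else - \int[@completed_lebesgue_measure R]_(s in `[b, a]) g s.

Section control_system.
Variables (R : realType) (d : nat) (U : metricType R) (T : R).
Variable f : 'rV[R]_d * U -> 'rV[R]_d.

(* Controls are total functions whose values outside [0, T] are irrelevant. *)
Definition admissible : set (R -> U) :=
  [set u | forall O : set U, open O ->
             lebesgue_measurable (`[0, T] `&` u @^-1` O)].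

(* [Phi tau t] is the flow Phi^u_(tau,t).  The integral equation of a solution
   presupposes an integrable right-hand side; this is made explicit because the
   library integral is a total function. *)
Definition controlled_flow (u : R -> U)
    (Phi : R -> R -> 'rV[R]_d -> 'rV[R]_d) : Prop :=
  forall tau t, tau \in `[0, T] -> t \in `[0, T] ->
    continuous (Phi tau t) /\
    forall x,
      (forall i, (@completed_lebesgue_measure R).-integrable `[0, T]
                   (fun s => (f (Phi tau s x, u s) ord0 i)%:E)) /\
      Phi tau t x = x + \row_(i < d)
        oriented_integral tau t (fun s => f (Phi tau s x, u s) ord0 i).

Definition Koopman (tau t : R) (phi : Cc R d) : set (Cc R d) :=
  [set psi | exists2 u, admissible u & exists2 Phi, controlled_flow u Phi &
               forall x, psi x = phi (Phi tau t x)].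

Definition Liouville (phi : Cc R d) : set (Cc R d) :=
  [set psi | exists u : U, forall x,
               psi x = \sum_(i < d) f (x, u) ord0 i *: partial phi i x].

Definition Koopman_quotient (tau : R) (phi : Cc R d) (t : R) : set (Cc R d) :=
  [set (t - tau)^-1 *: (psi - phi) | psi in Koopman tau t phi].

Definition controlled_fields : set (convex_lmodType ('rV[R]_d -> 'rV[R]_d)) :=
  [set (fun x => f (x, u)) | u in [set: U]].

Definition punctured_at (tau : R) : set_system R := within `[0, T] tau^'.

End control_system.

(* [edist_inf K x] is the distance from x to K, equal to +oo when K is empty. *)
Section Kuratowski_Painleve.
Variables (R : realType) (X : normedModType R).
Variables (F : set_system R) (K : R -> set X).

Definition KP_liminf : set X :=
  [set x | edist_inf (K t) x @[t --> F] --> 0%E].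

Definition KP_limsup : set X :=
  [set x | limf_einf (fun t => edist_inf (K t) x) F = 0%E].

Definition is_KP_lim (A : set X) : Prop := KP_liminf = A /\ KP_limsup = A.

End Kuratowski_Painleve.

Definition closed_convex_hull (R : realType) (X : normedModType R)
    (A : set X) : set X :=
  smallest [set C : set X | closed C /\ convex_set (C : set (convex_lmodType X))]
           A.

(* Main.v *)
Require Import Defs.
From HB Require Import structures.
From mathcomp Require Import all_boot all_order all_algebra.
From mathcomp Require Import complex.
From mathcomp Require Import all_classical all_reals all_analysis.
From mathcomp Require Import measurable_realfun ring lra.

(** Near [tau] a trajectory moves with bounded speed, so for a [C^1] function
    [phi] with compact support the quotient
    [(phi (Phi tau t x) - phi x) / (t - tau)] equals, up to an error that is
    uniform in [x], the average over [s] between [tau] and [t] of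
    [grad phi x . f (x, u s)].  An average of points of the Liouville set lies in
    its closed convex hull, which bounds the upper limit; a constant control
    [u0] makes the average equal to [grad phi . f (., u0)], which bounds the lower
    limit.  If the fields [f (., u)] form a convex set, then so do their Lie
    derivatives, and these form a compact set as a continuous image of [U]; the
    closed convex hull then adds nothing and both limits coincide.

    The uniform error estimate is [koopman_quotient_estimate].  It replaces the
    average by a finite convex combination: the control is discretized
    ([control_partition]) by pulling back a finite net of [U] and making the
    pieces disjoint, so that on each piece the velocity is close to
    [f (x, v j)] ([flow_increment_step]).  Since the velocity is only integrable
    in time, [phi] is not differentiated along a trajectory; instead
    [phi (x + w) - phi x] is compared with [sum_i w_i d_i phi x], uniformly in
    [x] ([first_order_expansion]).  Far from the support of [phi] everything
    vanishes, because the displacement over [|t - tau|] is at most a constant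
    times [(1 + |x|) |t - tau|] ([flow_displacement], [flow_escape]).

    The lower limit requires that the flow of a constant control exists
    ([autonomous_flow]).  It is obtained from Picard's iteration on the whole line
    for the field composed with the projection onto a large cube; Gronwall's
    inequality shows that the solution does not leave this cube on [[0, T]], and
    it also yields the continuous dependence on the initial point.  Both the
    convergence of the iteration and Gronwall's inequality rest on the weight
    [exp (2 l |t - tau|)]: integrating [l] times it gives at most half of it.

    All estimates use the max norm of ['rV[R]_d], to which the growth and
    Lipschitz hypotheses are transferred at the cost of a factor [d + 1]. *)

Set Implicit Arguments.
Unset Strict Implicit.
Unset Printing Implicit Defensive.

Import Order.TTheory GRing.Theory Num.Theory.
Import numFieldNormedType.Exports.

Local Open Scope classical_set_scope.
Local Open Scope ring_scope.

(** * Integration against the completed Lebesgue measure *)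

Section completed_lebesgue.
Variable R : realType.
Notation cmu := (@completed_lebesgue_measure R).
Notation lmu := (@lebesgue_measure R).
Notation cR := (caratheodory_type (@wlength R idfun)^*%mu).
Implicit Types (a b : R) (g h : R -> R).

Lemma borel_lebesgue_measurable (A : set R) :
  measurable A -> lebesgue_measurable A.
Proof. exact: sub_caratheodory. Qed.

Lemma measurable_fun_completed g (D : set R) : measurable D ->
  measurable_fun D g -> measurable_fun (D : set cR) (g : cR -> R).
Proof.
by move=> mD mg _ B mB; exact: (borel_lebesgue_measurable (mg mD B mB)).
Qed.

Lemma itv_lebesgue_measurable (i : interval R) :
  measurable ([set` i] : set cR).
Proof. by apply: borel_lebesgue_measurable; exact: measurable_itv. Qed.

Lemma completed_measure_itvcc a b : a <= b ->
  cmu `[a, b]%classic = (b - a)%:E.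
Proof.
move=> ab; rewrite [LHS](lebesgue_measure_itv `[a, b]) /= lte_fin.
by have [//|ba] := ltP a b; rewrite (@le_anti _ _ a b) ?ab// subrr.
Qed.

Lemma continuous_completed_integrable g a b : continuous g ->
  cmu.-integrable `[a, b] (EFin \o g).
Proof.
move=> cg; have cgw : {within `[a, b], continuous g}.
  exact: continuous_subspaceT.
apply: measurable_bounded_integrable.
- exact: itv_lebesgue_measurable.
- have [ab|ba] := leP a b; first by rewrite [X in (X < _)%E](completed_measure_itvcc ab) ltry.
  by rewrite set_itv_ge ?measure0// bnd_simp -ltNge.
- apply: measurable_fun_completed => //.
  by apply/measurable_funTS; exact: continuous_measurable_fun.
- have /compact_bounded := continuous_compact cgw (@segment_compact _ a b).
  move=> [M [Mr MM]]; exists M; split => // x /MM xM y /= yab.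
  by apply: xM; exists y.
Qed.

Lemma completed_Rintegral_set1 g a : \int[cmu]_(x in [set a]) g x = 0.
Proof.
rewrite (@eq_Rintegral _ _ _ _ _ (cst (g a))); last by move=> x /[!inE] ->.
rewrite Rintegral_cst -?set_itv1; last exact: itv_lebesgue_measurable.
rewrite set_itv1 -[RHS](mulr0 (g a)); congr (_ * _).
exact: (congr1 fine (lebesgue_measure_set1 a)).
Qed.

(** The identity pushes the completed measure forward to the Borel one, so the
    fundamental theorem of calculus transfers. *)
Lemma completed_Rintegral_FTC2 g (G : R -> R) a b : a <= b ->
  continuous g -> (forall x : R, is_derive x (1 : R) G (g x)) ->
  \int[cmu]_(x in `[a, b]) g x = G b - G a.
Proof.
rewrite le_eqVlt => /predU1P[-> cg dG|ab cg dG].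
  by rewrite subrr set_itv1 completed_Rintegral_set1.
have idm : measurable_fun [set: cR] (id : cR -> measurableTypeR R).
  by move=> _ B mB; rewrite setTI; exact: borel_lebesgue_measurable.
have mg : measurable_fun [set: measurableTypeR R] (EFin \o g).
  by apply/measurable_EFinP; exact: continuous_measurable_fun.
have ig := @continuous_completed_integrable g a b cg.
transitivity (fine (\int[pushforward cmu (id : cR -> measurableTypeR R)]_(x in `[a, b]) (g x)%:E)).
  by rewrite (integral_pushforward idm mg).
transitivity (fine (\int[lmu]_(x in `[a, b]) (g x)%:E)).
  by congr fine; apply: eq_measure_integral => A mA _.
have cG : continuous G.
  move=> x; apply/differentiable_continuous/derivable1_diffP.
  by case: (dG x).
rewrite (@continuous_FTC2 _ g G)//.
- exact: continuous_subspaceT.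
- by split; [move=> x _; case: (dG x)|
    apply: cvg_at_right_filter; exact: cG|apply: cvg_at_left_filter; exact: cG].
- by move=> x _; rewrite derive1E derive_val.
Qed.

(** The point [b] is counted twice on the right, but it is a null set. *)
Lemma completed_Rintegral_itv_cat g a b c : a <= b -> b <= c ->
  cmu.-integrable `[a, c] (EFin \o g) ->
  \int[cmu]_(x in `[a, c]) g x =
  \int[cmu]_(x in `[a, b]) g x + \int[cmu]_(x in `[b, c]) g x.
Proof.
move=> ab bc ig.
have oc (u v w : R) : u <= v -> v <= w -> `[u, w]%classic = `[u, v] `|` `]v, w].
  move=> uv vw; apply/seteqP; split => x /=; rewrite !in_itv/=.
    by move=> /andP[-> ->]; rewrite andbT/=; apply/orP; case: (leP x v).
  move=> [] /andP[h1 h2]; rewrite ?h1 ?h2 ?andbT/=.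
    by rewrite (le_trans h2).
  by rewrite (le_trans uv)// ltW.
have dis (u v w : R) : [disjoint `[u, v]%classic & `]v, w]%classic].
  apply/disj_setPS => x [] /=; rewrite !in_itv/= => /andP[_ xv] /andP[vx _].
  by move: (lt_le_trans vx xv); rewrite ltxx.
have mI := itv_lebesgue_measurable.
have sub (A : set R) : measurable (A : set cR) -> A `<=` `[a, c] ->
    cmu.-integrable A (EFin \o g).
  by move=> mA Aac; exact: integrableS ig.
rewrite (oc a b c)// Rintegral_setU//=; last by rewrite -oc.
congr (_ + _); rewrite (oc b b c)// Rintegral_setU//=; last first.
  rewrite -oc//; apply: sub => // x /=; rewrite !in_itv/= => /andP[h ->].
  by rewrite andbT (le_trans ab).
by rewrite set_itv1 completed_Rintegral_set1 add0r.
Qed.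

End completed_lebesgue.

(** * Oriented integrals *)

Section oriented_integral_theory.
Variable R : realType.
Notation cmu := (@completed_lebesgue_measure R).
Implicit Types (a b k l : R) (g h : R -> R).

(** The interval between [a] and [b] in either order; the sign of an oriented
    integral then separates from its size. *)
Definition hull a b : set R := [set` `[Num.min a b, Num.max a b]].

Lemma hullE a b s : hull a b s = (Num.min a b <= s <= Num.max a b).
Proof. by rewrite /hull/= in_itv. Qed.

Lemma hull_left a b : hull a b a.
Proof. by rewrite hullE ge_min le_max lexx. Qed.

Lemma hull_right a b : hull a b b.
Proof. by rewrite hullE ge_min le_max lexx !orbT. Qed.

Lemma hull_dist a b s : hull a b s -> `|s - a| <= `|b - a|.
Proof.
rewrite hullE minElt maxElt; case: (ltP a b) => [ab|ba] /andP[h1 h2].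
  by rewrite !ger0_norm ?subr_ge0 ?lerB// ltW.
by rewrite !ler0_norm ?subr_le0// lerN2 lerB.
Qed.

Lemma hull_sub (i : interval R) a b : a \in i -> b \in i ->
  hull a b `<=` [set` i].
Proof.
move=> ai bi s; rewrite hullE minElt maxElt /= => sab.
by case: ltP sab => _ sab; [apply: (interval_is_interval ai bi)|
  apply: (interval_is_interval bi ai)].
Qed.

Lemma hull_measurable a b :
  measurable (hull a b : set (caratheodory_type (@wlength R idfun)^*%mu)).
Proof. exact: itv_lebesgue_measurable. Qed.

Lemma hull_length a b : (cmu (hull a b) = `|b - a|%:E)%E.
Proof.
rewrite [LHS]completed_measure_itvcc; last by rewrite ge_min !le_max !lexx.
rewrite minElt maxElt; case: ltP => ab.
  by rewrite ger0_norm// subr_ge0 ltW.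
by rewrite ler0_norm ?opprB// subr_le0.
Qed.

Lemma integrable_hull (i : interval R) g a b : a \in i -> b \in i ->
  cmu.-integrable [set` i] (EFin \o g) ->
  cmu.-integrable (hull a b) (EFin \o g).
Proof.
move=> ai bi; apply: integrableS; [exact: itv_lebesgue_measurable|
  exact: hull_measurable|exact: hull_sub].
Qed.

Lemma oriented_integral_hull a b g :
  oriented_integral a b g = (-1) ^+ (b < a)%R * \int[cmu]_(s in hull a b) g s.
Proof.
rewrite /oriented_integral /hull minElt maxElt.
have [ab|ba] := leP a b.
  rewrite mul1r; move: ab; rewrite le_eqVlt => /predU1P[->|->]; last by [].
  by rewrite ltxx.
by rewrite mulN1r ltNge (ltW ba).
Qed.

Lemma norm_oriented_integral a b g :
  `|oriented_integral a b g| = `|\int[cmu]_(s in hull a b) g s|.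
Proof. by rewrite oriented_integral_hull normrM normrX normrN1 expr1n mul1r. Qed.

Lemma norm_oriented_integral_le a b g h :
  cmu.-integrable (hull a b) (EFin \o g) ->
  cmu.-integrable (hull a b) (EFin \o h) ->
  (forall s, hull a b s -> `|g s| <= h s) ->
  `|oriented_integral a b g| <= \int[cmu]_(s in hull a b) h s.
Proof.
move=> ig ih gh; rewrite norm_oriented_integral.
have mI := @hull_measurable a b.
apply: le_trans (le_normr_Rintegral mI ig) _.
apply: le_Rintegral => //.
by have := integrable_abse ig; rewrite (_ : (abse \o _) = (EFin \o (fun x => `|g x|))).
Qed.

Lemma norm_oriented_integral_le_cst a b g k :
  cmu.-integrable (hull a b) (EFin \o g) ->
  (forall s, hull a b s -> `|g s| <= k) ->
  `|oriented_integral a b g| <= k * `|b - a|.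
Proof.
move=> ig gk; have mI := @hull_measurable a b.
apply: le_trans (norm_oriented_integral_le ig (h := cst k) _ gk) _.
  by apply: continuous_completed_integrable; exact: cst_continuous.
by rewrite Rintegral_cst// [X in _ * fine X](hull_length a b).
Qed.

Lemma is_derive_expR_affine (l c x : R) : l != 0 ->
  is_derive x (1 : R) (fun s => l^-1 * expR (l * (s - c))) (expR (l * (x - c))).
Proof.
move=> l0.
apply: is_derive_eq.
by rewrite /GRing.scale/= subr0 mulr1 mulrCA mulVf// mulr1.
Qed.

(** Integrating the weight [exp (l |s - a|)] away from [a] gains a factor [1 / l]
    in both directions of time.  The contraction of Picard's operator and
    Gronwall's inequality both come from this gain. *)
Lemma norm_oriented_integral_le_exp a b g k l : 0 < l ->
  cmu.-integrable (hull a b) (EFin \o g) ->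
  (forall s, hull a b s -> `|g s| <= k * expR (l * `|s - a|)) ->
  `|oriented_integral a b g| <= k / l * expR (l * `|b - a|).
Proof.
move=> l0 ig gk.
have k0 : 0 <= k.
  have := gk _ (hull_left a b); rewrite subrr normr0 mulr0 expR0 mulr1.
  exact: le_trans.
have cexp c l' : continuous (fun s => expR (l' * (s - c))).
  move=> s; apply: continuous_comp; last exact: continuous_expR.
  apply: cvgMr; apply: cvgB; [exact: cvg_id|exact: cvg_cst].
have [ab|ba] := leP a b.
- have hE s : hull a b s -> `|s - a| = s - a.
    by rewrite hullE min_l// => /andP[as_ _]; rewrite ger0_norm// subr_ge0.
  apply: le_trans (norm_oriented_integral_le ig
    (h := fun s => k * expR (l * (s - a))) _ _) _.
  + by apply: continuous_completed_integrable => s; apply: cvgMr; exact: cexp.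
  + by move=> s sI; rewrite -hE// gk.
  + rewrite RintegralZl; [|exact: hull_measurable|
      exact: continuous_completed_integrable].
    rewrite /hull min_l// max_r//.
    rewrite (completed_Rintegral_FTC2 ab (cexp _ _)
      (fun x => is_derive_expR_affine a x (lt0r_neq0 l0))).
    rewrite -mulrBr mulrA ler_wpM2l// ?divr_ge0// ?(ltW l0)//.
    by rewrite ger0_norm ?subr_ge0// gerBl expR_ge0.
- have hE s : hull a b s -> l * `|s - a| = - l * (s - a).
    rewrite hullE max_l ?(ltW ba)// => /andP[_ as_].
    by rewrite ler0_norm ?mulrN ?mulNr// subr_le0.
  apply: le_trans (norm_oriented_integral_le ig
    (h := fun s => k * expR (- l * (s - a))) _ _) _.
  + by apply: continuous_completed_integrable => s; apply: cvgMr; exact: cexp.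
  + by move=> s sI; rewrite -hE// gk.
  + rewrite RintegralZl; [|exact: hull_measurable|
      exact: continuous_completed_integrable].
    have nl0 : - l != 0 by rewrite oppr_eq0 lt0r_neq0.
    rewrite /hull min_r ?max_l ?(ltW ba)//.
    rewrite (completed_Rintegral_FTC2 (ltW ba) (cexp _ _)
      (fun x => is_derive_expR_affine a x nl0)).
    rewrite -mulrBr mulrA invrN mulrN mulNr -mulrN opprB.
    rewrite ler_wpM2l ?divr_ge0 ?(ltW l0)// subrr mulr0 expR0.
    by rewrite ler0_norm ?subr_le0 ?(ltW ba)// mulNr mulrN gerBl.
Qed.

Lemma oriented_integralB a b g h :
  cmu.-integrable (hull a b) (EFin \o g) ->
  cmu.-integrable (hull a b) (EFin \o h) ->
  oriented_integral a b (fun s => g s - h s) =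
  oriented_integral a b g - oriented_integral a b h.
Proof.
move=> ig ih; rewrite !oriented_integral_hull RintegralB ?mulrBr//.
exact: hull_measurable.
Qed.

(** For a primitive based at the leftmost of the three points all integrals are
    differences of its values, so no case analysis on their order remains. *)
Lemma oriented_integral_cat a b c g : continuous g ->
  oriented_integral a c g = oriented_integral a b g + oriented_integral b c g.
Proof.
move=> cg; pose o := Num.min a (Num.min b c).
pose P x := \int[cmu]_(s in `[o, x]) g s.
have oE x y : o <= x -> o <= y -> oriented_integral x y g = P y - P x.
  move=> ox oy; rewrite /oriented_integral /P; have [xy|/ltW yx] := leP x y.
    rewrite (completed_Rintegral_itv_cat ox xy); first by rewrite addrC addKr.
    exact: continuous_completed_integrable.
  rewrite (completed_Rintegral_itv_cat oy yx); first by rewrite opprD addNKr.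
  exact: continuous_completed_integrable.
rewrite !oE /o ?ge_min ?lexx ?orbT//.
by rewrite [RHS]addrC addrA subrK.
Qed.

End oriented_integral_theory.

(** * Gronwall's inequality *)

Section gronwall.
Variables (R : realType) (d : nat).
Notation cmu := (@completed_lebesgue_measure R).

Lemma norm_coord_le (v : 'rV[R]_d) i : `|v ord0 i| <= `|v|.
Proof.
rewrite [leRHS]/Num.norm /= mx_normrE.
exact: (le_bigmax _ (fun ij : 'I_1 * 'I_d => `|v ij.1 ij.2|) (ord0, i)).
Qed.

Lemma norm_row_le (v : 'rV[R]_d) (b : R) : 0 <= b ->
  (forall i, `|v ord0 i| <= b) -> `|v| <= b.
Proof.
move=> b0 vb; rewrite [leLHS]/Num.norm /= mx_normrE.
by apply/bigmax_leP; split => // -[i j] _; rewrite (ord1 i).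
Qed.

Lemma norm_row_oriented_integral_le_exp (tau t k l : R) (h : 'I_d -> R -> R) :
  0 <= k -> 0 < l ->
  (forall i, cmu.-integrable (hull tau t) (EFin \o h i)) ->
  (forall i s, hull tau t s -> `|h i s| <= k * expR (l * `|s - tau|)) ->
  `|\row_i oriented_integral tau t (h i)| <= k / l * expR (l * `|t - tau|).
Proof.
move=> k0 l0 ih hk; apply: norm_row_le => [|i].
  by rewrite mulr_ge0 ?expR_ge0// divr_ge0// ltW.
by rewrite mxE; apply: norm_oriented_integral_le_exp => // s; exact: hk.
Qed.

Lemma norm_row_oriented_integral_le_cst (tau t k : R) (h : 'I_d -> R -> R) :
  0 <= k ->
  (forall i, cmu.-integrable (hull tau t) (EFin \o h i)) ->
  (forall i s, hull tau t s -> `|h i s| <= k) ->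
  `|\row_i oriented_integral tau t (h i)| <= k * `|t - tau|.
Proof.
move=> k0 ih hk; apply: norm_row_le => [|i]; first by rewrite mulr_ge0.
by rewrite mxE; apply: norm_oriented_integral_le_cst => // s; exact: hk.
Qed.

Lemma le_of_le_geometric (a b : R) : (forall n, a <= b * 2^-1 ^+ n) -> a <= 0.
Proof.
move=> ab; apply: (cvgr_to_ge (f := geometric b 2^-1) (F := \oo)).
  by apply: cvg_geometric; rewrite ger0_norm ?invr_ge0// invf_lt1// ltr1n.
by near=> n; exact: ab.
Unshelve. all: by end_near. Qed.

(** Each step improves the constant [k] to [a + k / 2]; these constants converge
    geometrically to the fixed point [2 * a]. *)
Lemma contraction_bound (D : set R) (e w : R -> R) (a b : R) :
  (forall s, D s -> e s <= b * w s) ->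
  (forall k, (forall s, D s -> e s <= k * w s) ->
     forall s, D s -> e s <= (a + k / 2) * w s) ->
  forall s, D s -> e s <= 2 * a * w s.
Proof.
move=> eb step; have en n s : D s -> e s <= (2 * a + (b - 2 * a) * 2^-1 ^+ n) * w s.
  elim: n s => [|n IH] s Ds; first by rewrite expr0 mulr1 addrC subrK eb.
  apply: le_trans (step _ IH s Ds) _.
  by rewrite le_eqVlt; apply/orP; left; apply/eqP; rewrite exprSr; field.
move=> s Ds; rewrite -subr_le0.
apply: (@le_of_le_geometric _ ((b - 2 * a) * w s)) => n.
by rewrite lerBlDl (le_trans (en n s Ds))// mulrDl lerD2l mulrAC.
Qed.

(** With the weight [exp (2 l |t - tau|)] the integral inequality turns a bound
    with constant [k] into one with constant [a + k / 2], and the integrability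
    of the [h i] provides a first bound; [contraction_bound] concludes. *)
Lemma gronwall (i0 : interval R) (tau a l : R) (e : R -> R) (h : 'I_d -> R -> R) :
  tau \in i0 -> 0 <= a -> 0 < l ->
  (forall i, cmu.-integrable [set` i0] (EFin \o h i)) ->
  (forall s, s \in i0 -> 0 <= e s) ->
  (forall i s, s \in i0 -> `|h i s| <= l * e s) ->
  (forall t, t \in i0 -> e t <= a + `|\row_i oriented_integral tau t (h i)|) ->
  forall t, t \in i0 -> e t <= 2 * a * expR (2 * l * `|t - tau|).
Proof.
move=> tau0 a0 l0 ih e0 he ea.
pose w t := expR (2 * l * `|t - tau|).
have w1 t : 1 <= w t by rewrite -expR0 ler_expR !mulr_ge0// ltW.
have mI := @itv_lebesgue_measurable R i0.
pose b := a + \sum_i \int[cmu]_(s in [set` i0]) `|h i s|.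
have ihn i : cmu.-integrable [set` i0] (EFin \o (fun s => `|h i s|)).
  by have := integrable_abse (ih i); rewrite (_ : (abse \o _) = (EFin \o (fun x => `|h i x|))).
have b0 : 0 <= \sum_i \int[cmu]_(s in [set` i0]) `|h i s|.
  by apply: sumr_ge0 => i _; exact: Rintegral_ge0.
apply: (@contraction_bound [set` i0] e w a b) => [t /= ti|k ek t /= ti].
  apply: le_trans (ler_peMr _ (w1 t)); last by rewrite addr_ge0.
  apply: le_trans (ea t ti) _; rewrite lerD2l; apply: norm_row_le => // i.
  rewrite mxE; apply: (@le_trans _ _ (\int[cmu]_(s in [set` i0]) `|h i s|)); last first.
    rewrite (bigD1 i)//= lerDl; apply: sumr_ge0 => j _; exact: Rintegral_ge0.
  have ihh := integrable_hull tau0 ti (ih i).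
  apply: le_trans (norm_oriented_integral_le ihh
    (integrable_hull tau0 ti (ihn i)) (fun _ _ => lexx _)) _.
  apply: fine_le.
  - by apply: integrable_fin_num; [exact: hull_measurable|
      exact: (integrable_hull tau0 ti (ihn i))].
  - exact: (integrable_fin_num mI (ihn i)).
  - apply: ge0_subset_integral => //; [exact: hull_measurable| |exact: hull_sub].
    by case/integrableP : (ihn i).
have k0 : 0 <= k.
  have := ek tau tau0; rewrite /w subrr normr0 mulr0 expR0 mulr1.
  by apply: le_trans; exact: e0.
apply: le_trans (ea t ti) _; rewrite mulrDl lerD//.
  by rewrite ler_peMr.
apply: le_trans (norm_row_oriented_integral_le_exp (k := l * k) (l := 2 * l) _ _ _ _) _.
- by rewrite mulr_ge0// ltW.
- by rewrite mulr_gt0.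
- by move=> i; exact: integrable_hull (ih i).
- move=> i s /(hull_sub tau0 ti) si; apply: le_trans (he i s si) _.
  by rewrite -mulrA ler_pM2l// ek.
- rewrite le_eqVlt; apply/orP; left; apply/eqP; congr (_ * _).
  by field; rewrite gt_eqF.
Qed.

End gronwall.

(** * The Cauchy problem for a bounded Lipschitz field *)

(** Matrices are a complete uniform space and a normed module; the join of the two
    structures lets normed sequences of row vectors converge. *)
HB.instance Definition _ (K : realType) (m n : nat) :=
  Complete.on 'M[K]_(m, n).

Section geometric_cauchy.
Variables (R : realType) (V : completeNormedModType R).

Lemma geometric_cauchy_cvg (u : nat -> V) (k : R) :
  (forall n, `|u n.+1 - u n| <= k * 2^-1 ^+ n) ->
  exists l, forall n, `|l - u n| <= 2 * k * 2^-1 ^+ n.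
Proof.
move=> uk; have unp n p : `|u (n + p)%N - u n| <= 2 * k * (2^-1 ^+ n - 2^-1 ^+ (n + p)).
  elim: p => [|p IH]; first by rewrite addn0 !subrr normr0 mulr0.
  rewrite addnS -(subrKA (u (n + p)%N)) (le_trans (ler_normD _ _))//.
  apply: le_trans (lerD (uk _) IH) _.
  by rewrite le_eqVlt; apply/orP; left; apply/eqP; rewrite exprS; field.
have k0 : 0 <= k by have := uk 0; rewrite expr0 mulr1; exact: le_trans.
have h0 n : 0 <= 2^-1 ^+ n :> R by rewrite exprn_ge0// invr_ge0.
have {}unp n p : `|u (n + p)%N - u n| <= 2 * k * 2^-1 ^+ n.
  apply: le_trans (unp n p) _; rewrite ler_wpM2l ?mulr_ge0//.
  by rewrite gerBl.
have ucvg : cvg (u @ \oo).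
  apply: cauchy_cvg; apply: cauchy_exP => e e0.
  have [n ne] : exists n, 2 * k * 2^-1 ^+ n < e.
    apply: contrapT => /forallNP H.
    have : e <= 0.
      apply: (@le_of_le_geometric _ _ (2 * k)) => n.
      by rewrite leNgt; apply/negP; exact: H.
    by rewrite leNgt e0.
  exists (u n); exists n => // m /= nm; rewrite -ball_normE /ball_/=.
  by rewrite distrC -(subnKC nm) (le_lt_trans (unp n _)).
exists (lim (u @ \oo)) => n.
apply: (cvgr_to_le (F := \oo) (f := fun m => `|u m - u n|)).
  by apply: cvg_norm; apply: cvgB => //; exact: cvg_cst.
by exists n => // m /= nm; rewrite -(subnKC nm) unp.
Qed.

End geometric_cauchy.

Lemma near_lipschitz_continuous (R : realType) (V W : normedModType R)
    (h : V -> W) (k : R) (x : V) :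
  (forall y, `|x - y| <= 1 -> `|h x - h y| <= k * `|x - y|) ->
  {for x, continuous h}.
Proof.
move=> hk; apply/cvgrPdist_le => e e0.
have k1 : 0 < Num.max k 1 by rewrite lt_max ltr01 orbT.
have ek : 0 < Num.min 1 (e / Num.max k 1) by rewrite lt_min ltr01 divr_gt0.
apply/nbhs_normP; exists (Num.min 1 (e / Num.max k 1)) => // y /= /ltW.
rewrite le_min ler_pdivlMr// => /andP[xy1 xye].
apply: le_trans (hk y xy1) _; apply: le_trans xye.
by rewrite mulrC ler_wpM2l// le_max lexx.
Qed.

Lemma lipschitz_continuous (R : realType) (V W : normedModType R)
    (h : V -> W) (k : R) :
  (forall x y, `|h x - h y| <= k * `|x - y|) -> continuous h.
Proof.
by move=> hk x; apply: (@near_lipschitz_continuous _ _ _ _ k) => y _; exact: hk.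
Qed.

Section picard.
Variables (R : realType) (d : nat).
Notation cmu := (@completed_lebesgue_measure R).
Variables (g : 'rV[R]_d -> 'rV[R]_d) (b l : R).
Hypotheses (l0 : 0 < l) (gb : forall x, `|g x| <= b)
  (gl : forall x y, `|g x - g y| <= l * `|x - y|).
Variables (tau : R) (x0 : 'rV[R]_d).

Let b0 : 0 <= b. Proof. exact: le_trans (normr_ge0 _) (gb 0). Qed.

Definition picard (c : R -> 'rV[R]_d) : R -> 'rV[R]_d :=
  fun t => x0 + \row_i oriented_integral tau t (fun s => g (c s) ord0 i).

Lemma continuous_rhs (c : R -> 'rV[R]_d) i : continuous c -> continuous (fun s => g (c s) ord0 i).
Proof.
move=> cc s; apply: (continuous_comp (f := fun s => g (c s)) (g := fun v => v ord0 i)).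
  by apply: continuous_comp; [exact: cc|exact: (lipschitz_continuous gl)].
exact: coord_continuous.
Qed.

(** The Lipschitz constant does not depend on [c], so it passes to pointwise limits
    of iterates and gives the continuity of such a limit. *)
Lemma picard_lipschitz (c : R -> 'rV[R]_d) : continuous c ->
  forall s t, `|picard c s - picard c t| <= b * `|s - t|.
Proof.
move=> cc s t; rewrite /picard opprD addrACA subrr add0r.
have -> : \row_i oriented_integral tau s (fun s => g (c s) ord0 i) -
    \row_i oriented_integral tau t (fun s => g (c s) ord0 i) =
    \row_i oriented_integral t s (fun s => g (c s) ord0 i).
  apply/rowP => i; rewrite !mxE.
  rewrite (oriented_integral_cat tau t s (@continuous_rhs c i cc)).
  by rewrite addrC addKr.
apply: norm_row_oriented_integral_le_cst => // [i|i r _].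
  by apply: continuous_completed_integrable; exact: continuous_rhs.
by apply: le_trans (gb (c r)); exact: norm_coord_le.
Qed.

Lemma picard_contract (c1 c2 : R -> 'rV[R]_d) k :
  continuous c1 -> continuous c2 ->
  (forall s, `|c1 s - c2 s| <= k * expR (2 * l * `|s - tau|)) ->
  forall s, `|picard c1 s - picard c2 s| <= k / 2 * expR (2 * l * `|s - tau|).
Proof.
move=> cc1 cc2 ck t; rewrite /picard opprD addrACA subrr add0r.
have k0 : 0 <= k.
  by have := ck tau; rewrite subrr normr0 mulr0 expR0 mulr1; exact/le_trans.
have i1 i : cmu.-integrable (hull tau t) (EFin \o (fun s => g (c1 s) ord0 i)).
  by apply: continuous_completed_integrable; exact: continuous_rhs.
have i2 i : cmu.-integrable (hull tau t) (EFin \o (fun s => g (c2 s) ord0 i)).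
  by apply: continuous_completed_integrable; exact: continuous_rhs.
have -> : \row_i oriented_integral tau t (fun s => g (c1 s) ord0 i) -
    \row_i oriented_integral tau t (fun s => g (c2 s) ord0 i) =
    \row_i oriented_integral tau t (fun s => g (c1 s) ord0 i - g (c2 s) ord0 i).
  by apply/rowP => i; rewrite !mxE -oriented_integralB.
apply: le_trans (norm_row_oriented_integral_le_exp (k := l * k) (l := 2 * l) _ _ _ _) _.
- by rewrite mulr_ge0// ltW.
- by rewrite mulr_gt0.
- move=> i; apply: continuous_completed_integrable => s.
  by apply: cvgB; exact: continuous_rhs.
- move=> i s _.
  rewrite (_ : g (c1 s) ord0 i - _ = (g (c1 s) - g (c2 s)) ord0 i); last by rewrite !mxE.
  apply: le_trans (norm_coord_le _ _) _; apply: le_trans (gl _ _) _.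
  by rewrite -mulrA ler_pM2l.
- rewrite le_eqVlt; apply/orP; left; apply/eqP; congr (_ * _).
  by field; rewrite gt_eqF.
Qed.

(** The weight makes the Picard operator a contraction on the whole line at once,
    so that local solutions need not be glued. *)
Lemma picard_fixpoint : exists2 c : R -> 'rV[R]_d, continuous c & c = picard c.
Proof.
pose u n := iter n picard (cst x0).
have cu n : continuous (u n).
  elim: n => [|n IH]; first exact: cst_continuous.
  exact: lipschitz_continuous (picard_lipschitz IH).
pose w t := expR (2 * l * `|t - tau|).
pose k := b / (2 * l).
have k0 : 0 <= k by rewrite divr_ge0// mulr_ge0// ltW.
have uu n t : `|u n.+1 t - u n t| <= k * 2^-1 ^+ n * w t.
  elim: n t => [|n IH] t.
    rewrite expr0 mulr1 /u/= {1}/picard addrAC subrr add0r.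
    apply: (@le_trans _ _ (b * `|t - tau|)).
      apply: norm_row_oriented_integral_le_cst => // [i|i r _].
        by apply: continuous_completed_integrable; exact: (@cst_continuous _ _ (g x0 ord0 i)).
      by apply: le_trans (gb (cst x0 r)); exact: norm_coord_le.
    (* [y <= exp y] for [y = 2 l |t - tau|] *)
    rewrite /k -mulrA ler_wpM2l// mulrC ler_pdivlMr ?mulr_gt0//.
    rewrite mulrC (le_trans _ (expR_ge1Dx _))//.
    by rewrite lerDr ler01.
  apply: le_trans (picard_contract (cu n.+1) (cu n) IH t) _.
  by rewrite le_eqVlt; apply/orP; left; apply/eqP; rewrite exprS /w; field.
have ul t : exists y, forall n, `|y - u n t| <= 2 * (k * w t) * 2^-1 ^+ n.
  have [n|y yu] := @geometric_cauchy_cvg R 'rV[R]_d (fun n => u n t) (k * w t).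
    by rewrite mulrAC.
  by exists y.
have [c uc] := choice ul.
have cL s t : `|c s - c t| <= b * `|s - t|.
  rewrite -subr_le0.
  apply: (@le_of_le_geometric _ _ (2 * (k * w s) + 2 * (k * w t))) => n.
  have half s' : 2 * (k * w s') * 2^-1 ^+ n.+1 <= 2 * (k * w s') * 2^-1 ^+ n.
    apply: ler_wpM2l; first by rewrite mulr_ge0// mulr_ge0// expR_ge0.
    by rewrite exprS ler_piMl ?exprn_ge0 ?invr_ge0// invf_le1// ler1n.
  have uc1 s' := le_trans (uc s' n.+1) (half s').
  rewrite lerBlDl (le_trans (ler_distD (u n.+1 s) _ _))//.
  rewrite mulrDl addrCA lerD//.
  rewrite (le_trans (ler_distD (u n.+1 t) _ _))// lerD//.
    exact: picard_lipschitz.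
  by rewrite distrC.
have cc : continuous c by exact: lipschitz_continuous cL.
exists c => //; apply/funext => t; apply/eqP; rewrite -subr_eq0 -normr_le0.
apply: (@le_of_le_geometric _ _ (2 * (k * w t))) => n.
have uc' s : `|c s - u n s| <= 2 * k * 2^-1 ^+ n * w s.
  by apply: le_trans (uc s n) _; rewrite mulrA mulrAC.
rewrite -(subrKA (u n.+1 t)) (le_trans (ler_normD _ _))//.
have up : `|u n.+1 t - picard c t| <= 2 * k * 2^-1 ^+ n / 2 * w t.
  by rewrite distrC; exact: picard_contract.
apply: le_trans (lerD (uc t n.+1) up) _.
by rewrite le_eqVlt; apply/orP; left; apply/eqP; rewrite exprS /w; field.
Qed.

End picard.

(** * Flows of autonomous fields with linear growth *)

Section clamp.
Variables (R : realType) (d : nat).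
Implicit Types (r : R) (x y : 'rV[R]_d).

(** Projection onto the cube of radius [r].  It is 1-Lipschitz for the max norm and
    does not increase it, so composing a field with it keeps the linear growth and
    makes the field bounded and globally Lipschitz. *)
Definition clamp r x : 'rV[R]_d :=
  \row_i Num.max (- r) (Num.min r (x ord0 i)).

Lemma norm_clamp_le r x : 0 <= r -> `|clamp r x| <= r.
Proof.
move=> r0; apply: norm_row_le => // i; rewrite mxE ler_norml.
by rewrite le_max lexx/= ge_max ge_min lexx/= andbT lerNl (le_trans _ r0)// oppr_le0.
Qed.

Lemma norm_clamp_le_id r x : 0 <= r -> `|clamp r x| <= `|x|.
Proof.
move=> r0; apply: norm_row_le => // i; rewrite mxE.
apply: le_trans (norm_coord_le x i).
have [h|h] := ltP (x ord0 i) (- r); last first.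
  rewrite max_r; last by rewrite le_min h andbT; lra.
  have [rx|xr] := leP r (x ord0 i); last by [].
  by rewrite !ger0_norm// (le_trans r0).
rewrite min_r ?max_l ?(ltW h)//; last by lra.
by rewrite normrN (ger0_norm r0) ler0_norm; lra.
Qed.

Lemma clamp_id r x : `|x| <= r -> clamp r x = x.
Proof.
move=> xr; apply/rowP => i; rewrite mxE.
have := le_trans (norm_coord_le x i) xr; rewrite ler_norml => /andP[h1 h2].
by rewrite min_r// max_r.
Qed.

Lemma clamp_lipschitz r x y : `|clamp r x - clamp r y| <= `|x - y|.
Proof.
apply: norm_row_le => // i; rewrite !mxE.
have := norm_coord_le (x - y) i; rewrite !mxE; apply: le_trans.
move: (x ord0 i) (y ord0 i) => a b.
have key (u v : R) : u <= v ->
    `|Num.max (- r) (Num.min r u) - Num.max (- r) (Num.min r v)| <= `|u - v|.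
  move=> uv; rewrite [leRHS]distrC [leRHS]ger0_norm ?subr_ge0//.
  rewrite distrC ger0_norm; last first.
    by rewrite subr_ge0 le_max2// le_min2.
  have [ru|ru] := leP r u; have [rv|rv] := leP r v.
  - by rewrite subrr subr_ge0.
  - by move: (le_lt_trans (le_trans ru uv) rv); rewrite ltxx.
  - by have [h1|h1] := leP (- r) u; have [h2|h2] := leP (- r) r; lra.
  - by have [h1|h1] := leP (- r) u; have [h2|h2] := leP (- r) v; lra.
have [ab|/ltW ba] := leP a b; first exact: key.
by rewrite distrC [leRHS]distrC key.
Qed.

End clamp.

Section a_priori_bound.
Variables (R : realType) (d : nat) (T m : R).
Notation cmu := (@completed_lebesgue_measure R).
Hypothesis m0 : 0 < m.

(** Gronwall's bound on [[0, T]] for [1 + |c|], where [c] starts in the ball of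
    radius [r] and has a speed of at most [m * (1 + |c|)]. *)
Definition flow_radius (r : R) : R := 2 * (1 + r) * expR (2 * m * T).

Lemma flow_radius_ge0 r : 0 <= r -> 0 <= flow_radius r.
Proof. by move=> r0; rewrite /flow_radius !mulr_ge0 ?expR_ge0 ?addr_ge0. Qed.

Lemma flow_radius_le r s : r <= s -> flow_radius r <= flow_radius s.
Proof.
move=> rs; rewrite ler_wpM2r ?expR_ge0// ler_wpM2l//.
by rewrite lerD2l.
Qed.

Lemma itv_dist_le (tau t : R) : tau \in `[0, T] -> t \in `[0, T] -> `|t - tau| <= T.
Proof. by rewrite !in_itv/= ler_norml => /andP[? ?] /andP[? ?]; lra. Qed.

Lemma solution_bound (tau : R) (x : 'rV[R]_d) (c : R -> 'rV[R]_d)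
    (h : 'I_d -> R -> R) : tau \in `[0, T] ->
  (forall i, cmu.-integrable `[0, T] (EFin \o h i)) ->
  (forall i (s : R), s \in `[0, T] -> `|h i s| <= m * (1 + `|c s|)) ->
  (forall t : R, t \in `[0, T] -> c t = x + \row_i oriented_integral tau t (h i)) ->
  forall t : R, t \in `[0, T] -> 1 + `|c t| <= flow_radius `|x|.
Proof.
move=> tau0 ih hc cE t t0.
apply: (@le_trans _ _ (2 * (1 + `|x|) * expR (2 * m * `|t - tau|))).
  apply: (gronwall (i0 := `[0, T]) (h := h) (e := fun s => 1 + `|c s|)) => //.
  by move=> s s0; rewrite -addrA lerD2l cE// ler_normD.
rewrite ler_wpM2l ?mulr_ge0 ?addr_ge0//.
by rewrite ler_expR ler_wpM2l ?mulr_ge0 ?(ltW m0)// itv_dist_le.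
Qed.

Lemma solution_displacement (tau : R) (x : 'rV[R]_d) (c : R -> 'rV[R]_d)
    (h : 'I_d -> R -> R) : tau \in `[0, T] ->
  (forall i, cmu.-integrable `[0, T] (EFin \o h i)) ->
  (forall i (s : R), s \in `[0, T] -> `|h i s| <= m * (1 + `|c s|)) ->
  (forall t : R, t \in `[0, T] -> c t = x + \row_i oriented_integral tau t (h i)) ->
  forall t : R, t \in `[0, T] -> `|c t - x| <= m * flow_radius `|x| * `|t - tau|.
Proof.
move=> tau0 ih hc cE t t0; rewrite cE// addrC addKr.
apply: norm_row_oriented_integral_le_cst => [|i|i s /(hull_sub tau0 t0) s0].
- by rewrite mulr_ge0 ?(ltW m0)// flow_radius_ge0.
- exact: integrable_hull (ih i).
- apply: le_trans (hc i s s0) _; rewrite ler_pM2l//.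
  exact: (solution_bound tau0 ih hc cE s0).
Qed.

End a_priori_bound.

Lemma oriented_integral_eq (R : realType) (a b : R) (g h : R -> R) :
  (forall s, hull a b s -> g s = h s) ->
  oriented_integral a b g = oriented_integral a b h.
Proof.
move=> gh; rewrite !oriented_integral_hull; congr (_ * _).
by apply: eq_Rintegral => s; rewrite inE => /gh.
Qed.

Section autonomous_flow.
Variables (R : realType) (d : nat) (T m : R).
Notation cmu := (@completed_lebesgue_measure R).
Variable g : 'rV[R]_d -> 'rV[R]_d.
Hypotheses (m0 : 0 < m) (g_continuous : continuous g).
Hypothesis g_growth : forall x, `|g x| <= m * (1 + `|x|).
Hypothesis g_lip : forall r, exists2 l, 0 < l &
  forall x y, `|x| <= r -> `|y| <= r -> `|g x - g y| <= l * `|x - y|.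

Notation rhs c i := (fun s => g (c s) ord0 i).

Lemma continuous_field_along (c : R -> 'rV[R]_d) i :
  continuous c -> continuous (rhs c i).
Proof.
move=> cc s; apply: (continuous_comp (f := fun s => g (c s)) (g := fun v => v ord0 i)).
  by apply: continuous_comp; [exact: cc|exact: g_continuous].
exact: coord_continuous.
Qed.

(** The a priori bound of [solution_bound] holds for the clamped field with the same
    constants, so its solution stays in the cube where clamping does nothing. *)
Lemma autonomous_solution (tau : R) (x : 'rV[R]_d) : tau \in `[0, T] ->
  exists2 c : R -> 'rV[R]_d, continuous c &
    forall t : R, t \in `[0, T] ->
      c t = x + \row_i oriented_integral tau t (rhs c i).
Proof.
move=> tau0; pose r := flow_radius T m `|x|.
have r0 : 0 <= r by exact: flow_radius_ge0.
pose G y := g (clamp r y).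
have [l l0 gl] := g_lip r.
have Gb y : `|G y| <= m * (1 + r).
  apply: le_trans (g_growth _) _; rewrite ler_pM2l// lerD2l.
  exact: norm_clamp_le.
have Gl y z : `|G y - G z| <= l * `|y - z|.
  apply: le_trans (gl _ _ (norm_clamp_le y r0) (norm_clamp_le z r0)) _.
  by rewrite ler_pM2l// clamp_lipschitz.
have [c cc cE] := picard_fixpoint l0 Gb Gl tau x.
have cE' t : c t = x + \row_i oriented_integral tau t (fun s => G (c s) ord0 i).
  by rewrite {1}cE.
exists c => // t t0; rewrite {1}cE'; congr (_ + _); apply/rowP => i; rewrite !mxE.
apply: oriented_integral_eq => s /(hull_sub tau0 t0) s0.
rewrite /G clamp_id//.
have := solution_bound m0 tau0 (c := c) (x := x) (h := fun i s => G (c s) ord0 i) _ _ _ s0.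
rewrite -/r => H; apply: le_trans (H _ _ _) => //.
- by rewrite lerDr.
- move=> j; apply: continuous_completed_integrable.
  exact: (@continuous_rhs _ _ G l Gl c j cc).
- move=> j s' _; apply: le_trans (norm_coord_le _ _) _.
  apply: le_trans (g_growth _) _; rewrite ler_pM2l// lerD2l.
  exact: norm_clamp_le_id.
Qed.

(** Solutions that start at distance at most 1 from [x] stay in one ball on [[0, T]];
    there the field is Lipschitz, and Gronwall's inequality applied to a difference
    of solutions gives the continuous dependence. *)
Lemma autonomous_flow : exists Phi : R -> R -> 'rV[R]_d -> 'rV[R]_d,
  forall tau t : R, tau \in `[0, T] -> t \in `[0, T] ->
    continuous (Phi tau t) /\
    forall x,
      (forall i, cmu.-integrable `[0, T] (EFin \o rhs (fun s => Phi tau s x) i)) /\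
      Phi tau t x = x + \row_(i < d)
        oriented_integral tau t (rhs (fun s => Phi tau s x) i).
Proof.
have /choice[P PE] (p : R * 'rV[R]_d) : exists c : R -> 'rV[R]_d, p.1 \in `[0, T] ->
    continuous c /\ forall t, t \in `[0, T] ->
      c t = p.2 + \row_i oriented_integral p.1 t (rhs c i).
  have [tau0|] := boolP (p.1 \in `[0, T]); last by exists (cst 0).
  by have [c cc cE] := autonomous_solution p.2 tau0; exists c.
(* Initial times outside of [[0, T]] have got an arbitrary curve. *)
exists (fun tau t x => P (tau, x) t) => tau t tau0 t0.
have Pc x := (PE (tau, x) tau0).1.
have PI x := (PE (tau, x) tau0).2.
have integ x i : cmu.-integrable `[0, T] (EFin \o rhs (P (tau, x)) i).
  by apply: continuous_completed_integrable; exact: continuous_field_along.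
split=> [x|x]; last by split => //; exact: PI.
pose r := flow_radius T m (`|x| + 1).
have bound y s : `|y| <= `|x| + 1 -> s \in `[0, T] -> `|P (tau, y) s| <= r.
  move=> yx s0; apply: le_trans (flow_radius_le T m yx).
  apply: le_trans (solution_bound m0 tau0 (integ y) _ (PI y) s0); first by rewrite lerDr.
  move=> i s' _; apply: le_trans (norm_coord_le _ _) _; exact: g_growth.
have [l l0 gl] := g_lip r.
pose K := 2 * expR (2 * l * `|t - tau|).
have dist y : `|y| <= `|x| + 1 -> `|P (tau, x) t - P (tau, y) t| <= K * `|x - y|.
  move=> yx; rewrite /K mulrAC.
  have xx : `|x| <= `|x| + 1 by rewrite lerDl.
  apply: (gronwall (i0 := `[0, T]) (a := `|x - y|)
    (e := fun s => `|P (tau, x) s - P (tau, y) s|)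
    (h := fun i s => rhs (P (tau, x)) i s - rhs (P (tau, y)) i s)) => //.
  - move=> i; apply: continuous_completed_integrable => s.
    by apply: cvgB; exact: continuous_field_along.
  - move=> i s s0.
    have -> : rhs (P (tau, x)) i s - rhs (P (tau, y)) i s =
      (g (P (tau, x) s) - g (P (tau, y) s)) ord0 i by rewrite !mxE.
    by apply: le_trans (norm_coord_le _ _) _; apply: gl; exact: bound.
  - move=> s s0; rewrite {1}PI// {1}[P (tau, y) s]PI//= opprD addrACA.
    apply: le_trans (ler_normD _ _) _; rewrite lerD2l.
    rewrite le_eqVlt; apply/orP; left; apply/eqP; congr (`|_|).
    apply/rowP => i; rewrite !mxE oriented_integralB//.
    + exact: integrable_hull (integ x i).
    + exact: integrable_hull (integ y i).
apply: (@near_lipschitz_continuous _ _ _ _ K) => y xy.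
apply: dist; have -> : y = x - (x - y) by rewrite opprB addrC subrK.
by apply: le_trans (ler_normB _ _) _; rewrite lerD2l.
Qed.

End autonomous_flow.

(** * Uniform continuity and mean values *)

(** Only [x] ranges over the compact set, so applications need no compact
    neighbourhood of [K] to accommodate [y]. *)
Lemma heine (R : realType) (X Y : pseudoMetricType R) (f : X -> Y) (K : set X)
    (e : R) : compact K -> continuous f -> 0 < e ->
  exists2 delta, 0 < delta &
    forall x y, K x -> ball x delta y -> ball (f x) e (f y).
Proof.
move=> /compact_near_coveringP cK cf e0.
pose P (delta : R) (x : X) := forall y, ball x delta y -> ball (f x) e (f y).
have /= : \forall delta \near (0 : R)^'+, K `<=` P delta.
  apply: cK => x Kx.
  have e2 : 0 < e / 2 by rewrite divr_gt0.
  have /nbhs_ballP[r r0 xr] : nbhs x (f @^-1` ball (f x) (e / 2)).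
    by apply: cf; exact: nbhsx_ballx.
  have r2 : 0 < r / 2 by rewrite divr_gt0.
  exists (ball x (r / 2), [set delta | delta < r / 2]).
    split; first exact: nbhsx_ballx.
    exact: nbhs_right_lt.
  move=> [x' delta] /= [xx' dr] y xy.
  apply: (@ball_splitr _ _ (f x)).
    apply: xr; apply: le_ball xx'.
    by rewrite ler_pdivrMr// mulr_natr mulr2n lerDl ltW.
  by apply: xr; apply: ball_split xx' _; exact: le_ball (ltW dr) _ xy.
rewrite near_withinE => -/nbhs_ballP[r /= r0 rP].
exists (r / 2); first by rewrite divr_gt0.
move=> x y Kx xy; apply: (rP (r / 2)) => //.
- rewrite -ball_normE/= sub0r normrN gtr0_norm ?divr_gt0//.
  by rewrite ltr_pdivrMr// ltr_pMr// ltr1n.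
- by rewrite /= divr_gt0.
Qed.

Section mean_value.
Variables (R : realType) (V W : normedModType R) (A : W -> R).
Hypotheses (AB : forall x y, A (x - y) = A x - A y)
  (AZ : forall (k : R) x, A (k *: x) = k * A x) (A1 : forall x, `|A x| <= `|x|).

Let A_continuous : continuous A.
Proof.
apply: (@lipschitz_continuous _ W (R : normedModType R) A 1) => x y.
by rewrite mul1r -AB.
Qed.

(** A vector-valued map has no mean value theorem, but its composition with a real
    linear functional [A] has one.  The functionals of interest are the real and
    the imaginary part. *)
Lemma functional_mean_value (phi : V -> W) (x h : V) :
  (forall y, differentiable phi y) ->
  exists s : R, 0 <= s <= 1 /\
    A (phi (x + h) - phi x) = A ('D_h phi (x + s *: h)).
Proof.
move=> dphi; pose g (s : R) : R := A (phi (x + s *: h)).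
have dg (s : R) : is_derive s (1 : R) g (A ('D_h phi (x + s *: h))).
  have /= dq := @diff_derivable _ _ _ phi (x + s *: h) h (dphi _).
  suff gl : (fun h0 : R => h0^-1 *: ((g \o shift s) (h0 *: (1 : R)) - g s)) @ 0^' -->
      A ('D_h phi (x + s *: h)).
    by split; [apply/cvg_ex; eexists; exact: gl|exact/cvg_lim].
  have -> : (fun h0 : R => h0^-1 *: ((g \o shift s) (h0 *: (1 : R)) - g s)) =
      A \o (fun h0 : R => h0^-1 *: ((phi \o shift (x + s *: h)) (h0 *: h) - phi (x + s *: h))).
    apply/funext => k /=; rewrite AZ AB /g; congr (_ * (A (phi _) - _)).
    by rewrite [k%:A]mulr1 scalerDl addrCA.
  by apply: continuous_cvg; [exact: A_continuous|exact: dq].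
have cg : continuous g.
  by move=> s; apply/differentiable_continuous/derivable1_diffP; case: (dg s).
have [s s01] := @MVT_segment R g _ 0 1 ler01 (fun s _ => dg s)
  (continuous_subspaceT cg).
rewrite subr0 mulr1 /g scale1r scale0r addr0 => sE.
by exists s; split; [move: s01; rewrite in_itv|rewrite AB].
Qed.

End mean_value.

(** * Test functions *)

Section compact_support.
Variables (R : realType) (d : nat).

Lemma closed_ball0_compact (r : R) : compact [set x : 'rV[R]_d | `|x| <= r].
Proof.
apply: bounded_closed_compact; last first.
  apply: (preimage_closed (f := fun x : 'rV[R]_d => `|x|)) (@closed_le R r).
  by move=> x _; exact: norm_continuous.
exists r; split; first exact: num_real.
by move=> s rs x /= /le_trans; apply; exact: ltW.
Qed.

Lemma Cc_support_bounded (g : Cc R d) :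
  exists2 r, 0 <= r & forall x, r < `|x| -> g x = 0.
Proof.
have /cont_compact_supportP[_ /compact_bounded[M [_ /(_ (Num.max M 0 + 1))]]] :=
  valP g.
rewrite ltr_pwDr ?le_max ?lexx// => /(_ isT) gM.
exists (Num.max M 0 + 1); first by rewrite addr_ge0// le_max lexx orbT.
move=> x; apply: contraPeq => gx0; apply/negP; rewrite -leNgt.
by apply: gM; exact: subset_closure.
Qed.

Lemma bounded_support_Cc (h : 'rV[R]_d -> Rcomplex R) (r : R) : continuous h ->
  (forall x, r < `|x| -> h x = 0) -> h \in @cont_compact_support R d.
Proof.
move=> ch hr; apply/cont_compact_supportP; split => //.
apply: (subclosed_compact (@closed_closure _ _) (closed_ball0_compact (r := r))).
have /closure_id -> : closed [set x : 'rV[R]_d | `|x| <= r].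
  by apply: compact_closed; [exact: norm_hausdorff|exact: closed_ball0_compact].
apply: closureS => x /= hx; rewrite leNgt; apply/negP => /hr h0.
by rewrite h0 eqxx in hx.
Qed.

Lemma Rcomplex_normE (a b : R) :
  `|(Complex a b : Rcomplex R)| = Num.sqrt (a ^+ 2 + b ^+ 2).
Proof. by []. Qed.

Lemma Rcomplex_norm_le (z : Rcomplex R) : `|z| <= `|complex.Re z| + `|complex.Im z|.
Proof.
case: z => a b; rewrite Rcomplex_normE /=.
rewrite -[leRHS]ger0_norm ?addr_ge0// -sqrtr_sqr ler_wsqrtr//.
rewrite sqrrD !real_normK ?num_real//.
by rewrite -addrA lerD2l lerDr mulrn_wge0// mulr_ge0.
Qed.

Lemma Rcomplex_Re_le (z : Rcomplex R) : `|complex.Re z| <= `|z|.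
Proof.
case: z => a b; rewrite Rcomplex_normE /= -[leLHS]sqrtr_sqr ler_wsqrtr//.
by rewrite lerDl sqr_ge0.
Qed.

Lemma Rcomplex_Im_le (z : Rcomplex R) : `|complex.Im z| <= `|z|.
Proof.
case: z => a b; rewrite Rcomplex_normE /= -[leLHS]sqrtr_sqr ler_wsqrtr//.
by rewrite lerDr sqr_ge0.
Qed.

End compact_support.

Section C1c_theory.
Variables (R : realType) (d : nat) (phi : Cc R d).
Hypothesis phi_C1 : C1c phi.

Let dphi x : differentiable phi x. Proof. by case: phi_C1. Qed.
Let cpartial i : continuous (partial phi i). Proof. by case: phi_C1. Qed.

Lemma partial_support (r : R) : (forall x, r < `|x| -> phi x = 0) ->
  forall i x, r < `|x| -> partial phi i x = 0.
Proof.
move=> phi0 i x rx; rewrite /partial.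
rewrite (@near_eq_derive _ _ _ _ (cst (0 : Rcomplex R))).
  exact: derive_cst.
have xr0 : 0 < `|x| - r by rewrite subr_gt0.
apply/nbhs_normP; exists (`|x| - r) => // y /= xy; apply: phi0.
by have := ler_distD y x 0; rewrite !subr0; lra.
Qed.

Lemma derive_partial (h x : 'rV[R]_d) :
  'D_h phi x = \sum_i h ord0 i *: partial phi i x.
Proof.
rewrite deriveE// {1}(row_sum_delta h) linear_sum; apply: eq_bigr => i _.
by rewrite linearZ /partial deriveE.
Qed.

Lemma partial_bounded : exists2 G : R, 0 <= G & forall i x, `|partial phi i x| <= G.
Proof.
have [r r0 phir] := Cc_support_bounded phi.
pose p i : Cc R d := MkCc (bounded_support_Cc (@cpartial i) (partial_support phir i)).
exists (\sum_i supnorm (p i)).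
  by apply: sumr_ge0 => i _; exact: le_trans (supnorm_ub (p i) 0).
move=> i x; apply: le_trans (supnorm_ub (p i) x) _.
rewrite (bigD1 i)//= lerDl; apply: sumr_ge0 => j _.
exact: le_trans (supnorm_ub (p j) 0).
Qed.

Lemma partial_unif_continuous (e : R) : 0 < e -> exists2 delta, 0 < delta &
  forall i x y, `|x - y| < delta -> `|partial phi i x - partial phi i y| <= e.
Proof.
move=> e0; have [r r0 phir] := Cc_support_bounded phi.
have /choice[D DP] i : exists delta, 0 < delta /\ forall x y : 'rV[R]_d,
    `|x| <= r + 1 -> `|x - y| < delta -> `|partial phi i x - partial phi i y| <= e.
  have [delta d0 dP] := heine (closed_ball0_compact (r := r + 1)) (@cpartial i) e0.
  exists delta; split => // x y xr xy.
  have := dP x y xr; rewrite -!ball_normE /= => /(_ xy); exact: ltW.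
exists (\big[Num.min/1]_i D i).
  by apply: lt_bigmin => // i _; case: (DP i).
move=> i x y xy.
have [xr|rx] := leP `|x| (r + 1).
  by apply: (DP i).2 => //; apply: lt_le_trans xy _; exact: bigmin_le.
have xy1 : `|x - y| < 1 by apply: lt_le_trans xy _; exact: bigmin_le_id.
rewrite !(partial_support phir) ?subrr ?normr0 ?(ltW e0)//; last lra.
by have := ler_distD y x 0; rewrite !subr0; lra.
Qed.

(** By the mean value theorem the real part of the remainder is the real part of
    [sum_i h_i (d_i phi (x + s h) - d_i phi x)] for some [s] in [[0, 1]], and
    likewise for the imaginary part; the partial derivatives are uniformly
    continuous because they have compact support. *)
Lemma first_order_expansion (e : R) : 0 < e -> exists2 delta, 0 < delta &
  forall x h : 'rV[R]_d, `|h| < delta ->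
  `|phi (x + h) - phi x - \sum_i h ord0 i *: partial phi i x| <= e * `|h|.
Proof.
(* The factor 2 accounts for the real and imaginary parts; [d.+1] bounds the number
   of terms and is nonzero also for [d = 0]. *)
move=> e0; pose eta := e / (2 * d.+1%:R).
have D0 : 0 < 2 * d.+1%:R :> R by rewrite mulr_gt0.
have eta0 : 0 < eta by rewrite divr_gt0.
have [delta d0 dP] := partial_unif_continuous eta0.
exists delta => // x h hd.
have key (A : Rcomplex R -> R) : (forall x y, A (x - y) = A x - A y) ->
    (forall (k : R) x, A (k *: x) = k * A x) -> (forall x, `|A x| <= `|x|) ->
    `|A (phi (x + h) - phi x - \sum_i h ord0 i *: partial phi i x)| <=
    d.+1%:R * eta * `|h|.
  move=> AB AZ A1; have [s [s01 sE]] := functional_mean_value AB AZ A1 x h dphi.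
  rewrite AB sE -AB derive_partial -sumrB.
  apply: le_trans (A1 _) _; apply: le_trans (ler_norm_sum _ _ _) _.
  apply: (@le_trans _ _ (\sum_(i < d) eta * `|h|)); last first.
    rewrite sumr_const card_ord -[leLHS]mulr_natl -mulrA; apply: ler_wpM2r.
      by rewrite mulr_ge0 ?(ltW eta0).
    by rewrite ler_nat.
  apply: ler_sum => i _; rewrite -scalerBr normrZ mulrC.
  apply: ler_pM => //; last exact: norm_coord_le.
  apply: dP; rewrite addrAC subrr add0r normrZ.
  apply: le_lt_trans hd; rewrite ler_piMl//.
  by case/andP: s01 => s0 s1; rewrite ger0_norm.
apply: le_trans (Rcomplex_norm_le _) _.
apply: le_trans (lerD (key (@complex.Re R) _ _ _) (key (@complex.Im R) _ _ _)) _.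
- by case=> a b [a' b'].
- by move=> k [a b].
- exact: Rcomplex_Re_le.
- by case=> a b [a' b'].
- by move=> k [a b].
- exact: Rcomplex_Im_le.
rewrite le_eqVlt; apply/orP; left; apply/eqP; rewrite /eta; field.
by rewrite addrC natr1 pnatr_eq0.
Qed.

End C1c_theory.

(** * Discretization of controls *)

Section step_functions.
Variable R : realType.
Notation cmu := (@completed_lebesgue_measure R).
Notation cR := (caratheodory_type (@wlength R idfun)^*%mu).

Lemma completed_Rintegral_bigsetU n (A : nat -> set R) (g : R -> R) :
  (forall j, measurable (A j : set cR)) -> trivIset setT A ->
  cmu.-integrable (\big[setU/set0]_(j < n) A j) (EFin \o g) ->
  \int[cmu]_(s in \big[setU/set0]_(j < n) A j) g s =
  \sum_(j < n) \int[cmu]_(s in A j) g s.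
Proof.
move=> mA tA; elim: n => [|n IH]; first by rewrite !big_ord0 Rintegral_set0.
have mU : measurable ((\big[setU/set0]_(j < n) A j) : set cR).
  by apply: bigsetU_measurable => j _; exact: mA.
rewrite !big_ord_recr /= => ig; rewrite Rintegral_setU//.
  rewrite IH//; apply: integrableS ig => //; exact: measurableU.
apply/disj_setPS => s [] /=; rewrite -bigcup_mkord => -[j /= jn Aj] An.
have jE := tA j n I I (ex_intro _ s (conj Aj An)).
by rewrite jE ltnn in jn.
Qed.

Definition partition_of (n : nat) (A : nat -> set R) (D : set R) :=
  [/\ forall j, measurable (A j : set cR), trivIset setT A &
      D = \big[setU/set0]_(j < n) A j].

(** The Lebesgue measure of [A] as a real number.  Writing it as an integral lets the
    integration lemmas apply to it. *)
Definition mass (A : set R) : R := \int[cmu]_(s in A) 1.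

Lemma mass_ge0 A : 0 <= mass A.
Proof. exact: Rintegral_ge0. Qed.

Lemma partition_sub n A D j : partition_of n A D -> (j < n)%N -> A j `<=` D.
Proof.
move=> [_ _ ->] jn s As; rewrite -bigcup_mkord; by exists j.
Qed.

Lemma mass_partition n A (a b : R) : partition_of n A (hull a b) ->
  \sum_(j < n) mass (A j) = `|b - a|.
Proof.
move=> [mA tA DE]; rewrite /mass -completed_Rintegral_bigsetU//.
  rewrite -DE Rintegral_cst ?mul1r; last exact: hull_measurable.
  exact: (congr1 fine (hull_length a b)).
by rewrite -DE; apply: continuous_completed_integrable; exact: cst_continuous.
Qed.

(** The integrand is within [e] of a step function, whose integral is the signed
    sum on the left. *)
Lemma oriented_integral_step n A (a b e : R) (g : R -> R) (c : nat -> R) :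
  partition_of n A (hull a b) -> cmu.-integrable (hull a b) (EFin \o g) ->
  (forall j s, (j < n)%N -> A j s -> `|g s - c j| <= e) ->
  `|oriented_integral a b g - (-1) ^+ (b < a)%R * \sum_(j < n) mass (A j) * c j|
    <= e * `|b - a|.
Proof.
move=> pA ig gc; have [mA tA DE] := pA.
have sub j h : (j < n)%N -> cmu.-integrable (hull a b) (EFin \o h) ->
    cmu.-integrable (A j) (EFin \o h).
  move=> jn; apply: integrableS => //; first exact: hull_measurable.
  exact: partition_sub pA jn.
have ic (k : R) : cmu.-integrable (hull a b) (EFin \o cst k).
  by apply: continuous_completed_integrable; exact: cst_continuous.
rewrite oriented_integral_hull -mulrBr normrM normrX normrN1 expr1n mul1r.
rewrite {1}DE completed_Rintegral_bigsetU//; last by rewrite -DE.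
rewrite -(mass_partition pA) -sumrB mulr_sumr.
apply: le_trans (ler_norm_sum _ _ _) _; apply: ler_sum => j _.
have -> : mass (A j) * c j = \int[cmu]_(s in A j) (cst (c j) s).
  rewrite mulrC /mass -RintegralZl//; last exact: sub (ic 1).
  by apply: eq_Rintegral => s _; rewrite mulr1.
rewrite -RintegralB//; [|exact: sub|exact: sub (ic _)].
have igc : cmu.-integrable (A j) (EFin \o (fun s => g s - c j)).
  have := integrableB (mA j) (sub j g (ltn_ord j) ig) (sub j _ (ltn_ord j) (ic (c j))).
  by [].
apply: le_trans (le_normr_Rintegral (mA j) igc) _.
rewrite /mass -RintegralZl//; last exact: sub (ic 1).
apply: le_Rintegral => //.
- by have := integrable_abse igc; rewrite (_ : (abse \o _) = (EFin \o (fun x => `|g x - c j|))).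
- have := sub j _ (ltn_ord j) (ic (e * 1)); by [].
- by move=> s As; rewrite mulr1 gc.
Qed.

End step_functions.

Section control_partition.
Variables (R : realType) (U : metricType R) (T : R).

(** Compactness in its near-covering form, for the filter of finite sequences
    directed by inclusion. *)
Lemma compact_finite_net (delta : R) : compact [set: U] -> 0 < delta ->
  exists s : seq U, forall x, exists2 v, v \in s & (ball v delta)° x.
Proof.
move=> /compact_near_coveringP cU d0.
pose F : set_system (seq U) := [set P | exists s0 : seq U,
  forall s : seq U, {subset s0 <= s} -> P s].
have FF : Filter F.
  split; first by exists [::].
    move=> P Q [s0 sP] [s1 sQ]; exists (s0 ++ s1) => s ss; split.
      by apply: sP => x xs; apply: ss; rewrite mem_cat xs.
    by apply: sQ => x xs; apply: ss; rewrite mem_cat xs orbT.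
  by move=> P Q PQ [s0 sP]; exists s0 => s /sP; exact: PQ.
have [|s0 /(_ s0) sU] := cU _ F (fun s x => exists2 v, v \in s & (ball v delta)° x) FF.
  move=> x _; exists ((ball x delta)°, [set s : seq U | x \in s]).
    split; first by apply: nbhs_interior; exact: nbhsx_ballx.
    by exists [:: x] => s; apply; rewrite mem_head.
  by move=> [y s] /= [xy xs]; exists x.
by exists s0 => x; exact: sU.
Qed.

(** The pieces are the preimages under [u] of the interiors of the balls of a finite
    net, made disjoint; interiors because admissibility speaks of open sets. *)
Lemma control_partition (u : R -> U) (a b delta : R) :
  compact [set: U] -> admissible T u -> a \in `[0, T] -> b \in `[0, T] ->
  0 < delta -> exists n (v : nat -> U) (A : nat -> set R),
    partition_of n A (hull a b) /\
    forall j s, (j < n)%N -> A j s -> ball (v j) delta (u s).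
Proof.
move=> cU au a0 b0 d0; have [vs vsU] := compact_finite_net cU d0.
pose v j := nth (u 0) vs j.
pose S j := hull a b `&` u @^-1` (ball (v j) delta)°.
have mS j : lebesgue_measurable (S j).
  have -> : S j = hull a b `&` (`[0, T] `&` u @^-1` (ball (v j) delta)°).
    apply/seteqP; split => [s [sab su]|s [sab [_ su]]]; last by split.
    by split => //; split => //; exact: hull_sub a0 b0 _ sab.
  apply: measurableI; first exact: hull_measurable.
  by apply: au; exact: open_interior.
exists (size vs), v, (seqDU S); split; last first.
  by move=> j s _ /(@subset_seqDU _ S j) [_ /= su]; exact: interior_subset su.
split.
- move=> j; apply: measurableD; first exact: mS.
  by apply: bigsetU_measurable => k _; exact: mS.
- exact: trivIset_seqDU.
- rewrite -bigsetU_seqDU -bigcup_mkord; apply/seteqP; split => s; last first.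
    by move=> [j _ []].
  move=> sab; have [w ws wu] := vsU (u s).
  exists (index w vs); first by rewrite /= index_mem.
  by split => //; rewrite /v/= nth_index.
Qed.

End control_partition.

(** * First-order expansion of the Koopman quotients *)

Section koopman_quotient.
Variables (R : realType) (d : nat) (U : metricType R) (T m : R).
Variable f : 'rV[R]_d * U -> 'rV[R]_d.
Hypotheses (U_compact : compact [set: U]) (f_continuous : continuous f).
Hypotheses (m0 : 0 < m) (f_growth : forall x u, `|f (x, u)| <= m * (1 + `|x|)).
Variable tau : R.
Hypothesis tau0T : tau \in `[0, T].

(** A trajectory that starts in the ball of radius [r] has at most this speed on
    [[0, T]]. *)
Definition flow_speed (r : R) : R := m * flow_radius T m r.

Lemma flow_speed_gt0 r : 0 <= r -> 0 < flow_speed r.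
Proof.
by move=> r0; rewrite /flow_speed /flow_radius !mulr_gt0 ?expR_gt0 ?ltr_pwDl.
Qed.

Lemma flow_displacement u Phi x t : controlled_flow T f u Phi ->
  t \in `[0, T] -> `|Phi tau t x - x| <= flow_speed `|x| * `|t - tau|.
Proof.
move=> PhiE t0T.
apply: (solution_displacement m0 (c := fun s => Phi tau s x)
  (h := fun i s => f (Phi tau s x, u s) ord0 i)) => //.
- by case: (PhiE tau tau tau0T tau0T) => _ /(_ x)[].
- by move=> i s _; apply: le_trans (norm_coord_le _ _) _; exact: f_growth.
- by move=> s s0; case: (PhiE tau s tau0T s0) => _ /(_ x)[].
Qed.

(** As [flow_speed] is affine in the radius, the displacement is at most half of
    [1 + |x|] for [t] close to [tau], uniformly in [x]: a distant point cannot reach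
    the support of a test function. *)
Lemma flow_escape u Phi x t r : controlled_flow T f u Phi -> t \in `[0, T] ->
  `|t - tau| <= (2 * flow_speed 0)^-1 -> 2 * r + 1 < `|x| ->
  r < `|Phi tau t x|.
Proof.
set C := flow_speed 0; have C0 : 0 < C by exact: flow_speed_gt0.
move=> PhiE t0T tC rx; have := flow_displacement x PhiE t0T.
have -> : flow_speed `|x| = C * (1 + `|x|).
  by rewrite /C /flow_speed /flow_radius; ring.
have h1 : C * (1 + `|x|) * `|t - tau| <= (1 + `|x|) / 2.
  rewrite mulrAC mulrC ler_wpM2l ?addr_ge0//.
  by rewrite mulrC -ler_pdivlMr// (le_trans tC)// invfM.
have := ler_distD (Phi tau t x) x 0; rewrite !subr0 (distrC x).
by move: rx h1; lra.
Qed.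

(** The velocity is within [e] of the step function with value [f (x, v j)] on
    [A j], and [t - tau] times the average of the latter is its oriented
    integral. *)
Lemma flow_increment_step u Phi x t e n (v : nat -> U) (A : nat -> set R) :
  controlled_flow T f u Phi -> t \in `[0, T] -> t != tau -> 0 <= e ->
  partition_of n A (hull tau t) ->
  (forall j s, (j < n)%N -> A j s -> `|f (Phi tau s x, u s) - f (x, v j)| <= e) ->
  `|Phi tau t x - x - (t - tau) *: \sum_(j < n) (mass (A j) / `|t - tau|) *: f (x, v j)|
    <= e * `|t - tau|.
Proof.
move=> PhiE t0T ttau e0 pA fe.
have [_ /(_ x) [iPhi {1}->]] := PhiE tau t tau0T t0T.
apply: norm_row_le => [|i]; first by rewrite mulr_ge0.
rewrite !mxE [x ord0 i + _]addrC addrK summxE.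
have := oriented_integral_step (c := fun j => f (x, v j) ord0 i) (e := e) pA
  (integrable_hull tau0T t0T (iPhi i)).
move=> /(_ _); set X := (X in _ * X); set Y := (Y in (t - tau) * Y).
have -> : (t - tau) * Y = (-1) ^+ (t < tau)%R * X.
  have -> : X = `|t - tau| * Y.
    rewrite /X /Y mulr_sumr; apply: eq_bigr => j _; rewrite !mxE.
    by field; rewrite normr_eq0 subr_eq0.
  rewrite mulrA; congr (_ * _); have [h|h] := ltP t tau.
    by rewrite ltr0_norm ?subr_lt0// mulN1r opprK.
  by rewrite ger0_norm ?subr_ge0// mul1r.
apply=> j s jn Aj; apply: le_trans (fe j s jn Aj).
by apply: le_trans (norm_coord_le _ i); rewrite !mxE.
Qed.

Variable phi : Cc R d.
Hypothesis phi_C1 : C1c phi.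

(** The Lie derivative of [phi] along [f (., u)]. *)
Definition lie (u : U) (x : 'rV[R]_d) : Rcomplex R :=
  \sum_(i < d) f (x, u) ord0 i *: partial phi i x.

Lemma lie_sum n (c : 'I_n -> R) (v : 'I_n -> U) x :
  \sum_(j < n) c j *: lie (v j) x =
  \sum_(i < d) (\sum_(j < n) c j *: f (x, v j)) ord0 i *: partial phi i x.
Proof.
under eq_bigr do rewrite scaler_sumr.
rewrite exchange_big; apply: eq_bigr => i _.
rewrite summxE scaler_suml; apply: eq_bigr => j _.
by rewrite scalerA mxE.
Qed.

(** With [w = Phi tau t x - x] and [V] the average of the [f (x, v j)], the error
    splits into the remainder of the first-order expansion of [phi] at [x] and
    [sum_i (w - (t - tau) V)_i d_i phi x].  Neither is larger than [e / 2] times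
    [|t - tau|].  Outside of a fixed ball all terms vanish. *)
Lemma koopman_quotient_estimate e : 0 < e ->
  exists2 delta, 0 < delta & exists2 eta, 0 < eta &
  forall u Phi t n (v : nat -> U) (A : nat -> set R),
    controlled_flow T f u Phi -> t \in `[0, T] -> t != tau ->
    `|t - tau| < eta -> partition_of n A (hull tau t) ->
    (forall j s, (j < n)%N -> A j s -> ball (v j) delta (u s)) ->
    forall x, `|(t - tau)^-1 *: (phi (Phi tau t x) - phi x) -
      \sum_(j < n) (mass (A j) / `|t - tau|) *: lie (v j) x| <= e.
Proof.
move=> e0; have [r r0 phir] := Cc_support_bounded phi.
have [G G0 GP] := partial_bounded phi_C1.
pose rho := 2 * r + 1.
have rho0 : 0 <= rho by rewrite addr_ge0 ?mulr_ge0.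
pose B := flow_speed rho; have B0 : 0 < B by exact: flow_speed_gt0.
pose C := flow_speed 0; have C0 : 0 < C by exact: flow_speed_gt0.
(* [e1] bounds the error on the velocity, which is multiplied by the [d] partial
   derivatives; [e2] is the relative error of the expansion of [phi], which is
   multiplied by the speed [B]. *)
pose e1 := e / (2 * (d%:R * G + 1)).
have dG0 : 0 < d%:R * G + 1 by rewrite ltr_wpDl ?mulr_ge0.
have e10 : 0 < e1 by rewrite divr_gt0// mulr_gt0.
pose e2 := e / (2 * B).
have e20 : 0 < e2 by rewrite divr_gt0// mulr_gt0.
have [d2 d20 d2P] := first_order_expansion phi_C1 e20.
have [d1 d10 d1P] := heine (compact_setX (closed_ball0_compact (r := rho)) U_compact)
  f_continuous e10.
exists d1 => //.
(* The three bounds serve [flow_escape], the modulus of continuity of [f] and the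
   expansion of [phi]. *)
exists (Num.min (2 * C)^-1 (Num.min (d1 / B) (d2 / B))).
  by rewrite !lt_min invr_gt0 mulr_gt0// !divr_gt0.
move=> u Phi t n v A PhiE t0T ttau; rewrite !lt_min => /and3P[tC t1 t2] pA uA x.
have Dn0 : 0 < `|t - tau| by rewrite normr_gt0 subr_eq0.
have [xrho|rhox] := leP `|x| rho; last first.
  have rx : r < `|x| by apply: lt_trans rhox; rewrite /rho; lra.
  have rPhi : r < `|Phi tau t x|.
    exact: (flow_escape PhiE t0T (ltW tC) rhox).
  have lie0 w : lie w x = 0.
    by rewrite /lie big1// => i _; rewrite (partial_support phir)// scaler0.
  rewrite !phir// subrr scaler0 big1 ?subrr ?normr0 ?(ltW e0)// => j _.
  by rewrite lie0 scaler0.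
have dispB s : hull tau t s -> `|Phi tau s x - x| <= B * `|t - tau|.
  move=> st; have s0T := hull_sub tau0T t0T st.
  apply: le_trans (flow_displacement x PhiE s0T) _.
  apply: ler_pM => //; last exact: hull_dist.
    by rewrite ltW// flow_speed_gt0.
  by rewrite /B /flow_speed ler_pM2l// flow_radius_le.
pose w := Phi tau t x - x.
have wB : `|w| <= B * `|t - tau| by apply: dispB; exact: hull_right.
pose V := \sum_(j < n) (mass (A j) / `|t - tau|) *: f (x, v j).
have wV : `|w - (t - tau) *: V| <= e1 * `|t - tau|.
  apply: (flow_increment_step PhiE t0T ttau (ltW e10) pA) => j s jn As.
  have st := partition_sub pA jn As.
  have : ball (f (x, v j)) e1 (f (Phi tau s x, u s)).
    apply: d1P; first by split.
    split => /=; last exact: uA.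
    rewrite -ball_normE/= distrC (le_lt_trans (dispB s st))//.
    by rewrite mulrC -ltr_pdivlMr.
  by rewrite -ball_normE /= distrC; exact: ltW.
have d2w : `|w| < d2 by rewrite (le_lt_trans wB)// mulrC -ltr_pdivlMr.
have -> : (t - tau)^-1 *: (phi (Phi tau t x) - phi x) -
    \sum_(j < n) (mass (A j) / `|t - tau|) *: lie (v j) x =
  (t - tau)^-1 *: ((phi (x + w) - phi x - \sum_i w ord0 i *: partial phi i x) +
    \sum_i (w - (t - tau) *: V) ord0 i *: partial phi i x).
  rewrite (lie_sum _ v) -/V /w [x + _]addrC subrK -/w.
  have -> : \sum_i (w - (t - tau) *: V) ord0 i *: partial phi i x =
     \sum_i w ord0 i *: partial phi i x -
     (t - tau) *: \sum_i V ord0 i *: partial phi i x.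
    rewrite [X in _ = _ - X]scaler_sumr -sumrB; apply: eq_bigr => i _.
    by rewrite !mxE scalerBl scalerA.
  rewrite [X in _ = _ *: X]addrA subrK [RHS]scalerBr scalerA mulVf ?scale1r//.
  by rewrite subr_eq0.
rewrite normrZ normfV ler_pdivrMl//.
apply: le_trans (ler_normD _ _) _.
have key2 : `|\sum_i (w - (t - tau) *: V) ord0 i *: partial phi i x| <=
    d%:R * (e1 * `|t - tau| * G).
  apply: le_trans (ler_norm_sum _ _ _) _.
  apply: (@le_trans _ _ (\sum_(i < d) (e1 * `|t - tau| * G))).
    apply: ler_sum => i _; rewrite normrZ; apply: ler_pM => //.
    exact: le_trans (norm_coord_le _ _) wV.
  by rewrite sumr_const card_ord mulr_natl.
apply: le_trans (lerD (le_trans (d2P x w d2w) _) key2) _.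
  by apply: ler_wpM2l wB; exact: ltW.
have E1 : e2 * B = e / 2 by rewrite /e2; field; rewrite gt_eqF.
have E2 : (d%:R * G + 1) * e1 = e / 2 by rewrite /e1; field; rewrite gt_eqF.
rewrite (_ : _ + _ = `|t - tau| * (e2 * B + d%:R * G * e1)); last by ring.
rewrite ler_pM2l// E1.
have : d%:R * G * e1 <= (d%:R * G + 1) * e1 by rewrite ler_pM2r// lerDl.
by rewrite E2; lra.
Qed.

End koopman_quotient.

(** * Kuratowski-Painleve limits, convexity and times near tau *)

Section kuratowski_painleve.
Variables (R : realType) (X : normedModType R).
Implicit Types (F : set_system R) (K : R -> set X) (x : X).

Lemma edist_inf_le (A : set X) x y (e : R) :
  0 < e -> A y -> `|x - y| < e -> (edist_inf A x <= e%:E)%E.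
Proof.
move=> e0 Ay xy; apply: ge_ereal_inf; exists (edist (x, y)); first by exists y.
by apply: edist_fin => //; rewrite -ball_normE.
Qed.

Lemma edist_inf_lt (A : set X) x (e : R) :
  (edist_inf A x < e%:E)%E -> exists2 y, A y & `|x - y| < e.
Proof.
move=> /ereal_inf_lt[_ [y Ay <-]] /edist_lt_ball; rewrite -ball_normE => xy.
by exists y.
Qed.

Lemma KP_liminf_approx F K x : Filter F ->
  (forall e, 0 < e -> \forall t \near F, exists2 y, K t y & `|x - y| < e) ->
  KP_liminf F K x.
Proof.
move=> FF Kx.
have Ke e : 0 < e -> \forall t \near F, (edist_inf (K t) x <= e%:E)%E.
  move=> e0; apply: filterS (Kx e e0) => t [y Ky xy].
  exact: edist_inf_le e0 Ky xy.
rewrite /KP_liminf /=; apply/fine_cvgP; split.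
  apply: filterS (Ke 1 ltr01) => t tle.
  by rewrite ge0_fin_numE ?edist_inf_ge0// (le_lt_trans tle)// ltry.
apply/cvgrPdist_le => e e0; apply: filterS (Ke e e0) => t tle /=.
rewrite sub0r normrN ger0_norm ?fine_ge0 ?edist_inf_ge0//.
rewrite -lee_fin fineK// ge0_fin_numE ?edist_inf_ge0//.
by rewrite (le_lt_trans tle)// ltry.
Qed.

Lemma KP_limsup_approx F K x : KP_limsup F K x ->
  forall e, 0 < e -> forall V, F V ->
  exists t, V t /\ exists2 y, K t y & `|x - y| < e.
Proof.
rewrite /KP_limsup /= limf_einfE => x0 e e0 V FV.
have : (ereal_inf [set edist_inf (K t) x | t in V] < e%:E)%E.
  apply: le_lt_trans (_ : 0%E < e%:E)%E; last by rewrite lte_fin.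
  by rewrite -x0; apply: ereal_sup_ubound; exists V.
move=> /ereal_inf_lt[_ [t Vt <-]] /edist_inf_lt ty.
by exists t.
Qed.

Lemma KP_liminf_limsup F K : ProperFilter F -> KP_liminf F K `<=` KP_limsup F K.
Proof.
move=> FF x /= Kx; rewrite /KP_limsup /= limf_einfE; apply/eqP.
rewrite eq_le; apply/andP; split.
  apply: ge_ereal_sup => _ [V FV <-]; apply/lee_addgt0Pr => e e0; rewrite add0e.
  have /fine_cvgP[Kfin /cvgrPdist_le/(_ e e0) Ke] := Kx.
  have [t [Vt [tfin te]]] := filter_ex (filterI FV (filterI Kfin Ke)).
  apply: ge_ereal_inf; exists (edist_inf (K t) x); first by exists t.
  move: te; rewrite /= sub0r normrN -lee_fin => te.
  by rewrite -(fineK tfin) (le_trans _ te)// lee_fin ler_norm.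
apply: (@le_trans _ _ (ereal_inf [set edist_inf (K t) x | t in setT])).
  by apply: le_ereal_inf_tmp => _ [t _ <-]; exact: edist_inf_ge0.
by apply: ereal_sup_ubound; exists setT => //; exact: filterT.
Qed.

End kuratowski_painleve.

Section convexity.
Variables (R : realType) (X : lmodType R) (C : set (convex_lmodType X)).
Hypothesis C_convex : convex_set C.

Lemma convex_set2 (x y : X) (p : R) : 0 <= p -> p <= 1 -> C x -> C y ->
  C (p *: x + (1 - p) *: y).
Proof.
move=> p0 p1 Cx Cy; have := C_convex (Itv01 p0 p1) (mem_set Cx) (mem_set Cy).
by rewrite inE.
Qed.

(** Induction on the number of points, for partial sums divided by their total
    weight. *)
Lemma convex_combination n (c : nat -> R) (a : nat -> X) :
  (forall j, 0 <= c j) -> (forall j, C (a j)) ->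
  \sum_(j < n) c j = 1 -> C (\sum_(j < n) c j *: a j).
Proof.
move=> c0 Ca c1.
suff H k : 0 < \sum_(j < k) c j ->
    C ((\sum_(j < k) c j)^-1 *: \sum_(j < k) c j *: a j).
  by have := H n; rewrite c1 invr1 scale1r; apply; exact: ltr01.
elim: k => [|k IH]; first by rewrite big_ord0 ltxx.
rewrite !big_ord_recr /=; set S := \sum_(j < k) c j => Sc.
have S0 : 0 <= S by apply: sumr_ge0.
move: S0; rewrite le_eqVlt => /predU1P[S0|S0].
  have z : \sum_(j < k) c j *: a j = 0.
    apply: big1 => j _; have := esym S0.
    by move=> /psumr_eq0P => /(_ (fun i _ => c0 i) j isT) ->; rewrite scale0r.
  rewrite z -S0 !add0r scalerA mulVf ?scale1r//.
  by move: Sc; rewrite -S0 add0r => /lt0r_neq0.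
have p1 : S / (S + c k) <= 1 by rewrite ler_pdivrMr// mul1r lerDl.
have := convex_set2 (divr_ge0 (ltW S0) (ltW Sc)) p1 (IH S0) (Ca k).
congr (C _); rewrite scalerDr !scalerA; congr (_ *: _ + _ *: _).
  by rewrite -/S; field; rewrite !gt_eqF.
by field; rewrite gt_eqF.
Qed.

End convexity.

Section punctured.
Variables (R : realType) (T tau : R).
Hypotheses (T0 : 0 < T) (tau0T : tau \in `[0, T]).

Lemma punctured_atP (V : set R) : punctured_at T tau V <->
  exists2 e, 0 < e &
    forall t, t \in `[0, T] -> t != tau -> `|t - tau| < e -> V t.
Proof.
rewrite /punctured_at /within /=; split.
  move=> /nbhs_ballP[e /= e0 eV]; exists e => // t t0T ttau te.
  by apply: eV => //; rewrite -ball_normE/= distrC.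
move=> [e e0 eV]; apply/nbhs_ballP; exists e => //= t.
by rewrite -ball_normE/= distrC => te ttau t0T; exact: eV.
Qed.

Lemma punctured_proper : ProperFilter (punctured_at T tau).
Proof.
split; last exact: within_filter.
move=> /punctured_atP[e e0 H].
move: tau0T; rewrite in_itv/= => /andP[h1 h2].
have [tT|Tt] := ltP tau T.
  pose k := Num.min (T - tau) (e / 2).
  have k0 : 0 < k by rewrite lt_min subr_gt0 tT divr_gt0.
  have kT : k <= T - tau by rewrite ge_min lexx.
  have ke : k <= e / 2 by rewrite ge_min lexx orbT.
  apply: (H (tau + k)).
  - by rewrite in_itv/=; lra.
  - by rewrite gt_eqF// ltrDl.
  - by rewrite addrAC subrr add0r gtr0_norm//; lra.
pose k := Num.min T (e / 2).
have k0 : 0 < k by rewrite lt_min T0 divr_gt0.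
have kT : k <= T by rewrite ge_min lexx.
have ke : k <= e / 2 by rewrite ge_min lexx orbT.
apply: (H (tau - k)).
- by rewrite in_itv/=; lra.
- by rewrite lt_eqF// gtrBl.
- by rewrite addrAC subrr add0r normrN gtr0_norm//; lra.
Qed.

End punctured.

(** * The Liouville operator as infinitesimal generator *)

Section Cc_evaluation.
Variables (R : realType) (d : nat).

Lemma Cc_sumE n (c : 'I_n -> R) (g : 'I_n -> Cc R d) x :
  (\sum_(j < n) c j *: g j) x = \sum_(j < n) c j *: g j x.
Proof.
elim: n c g => [|n IH] c g; first by rewrite !big_ord0.
by rewrite !big_ord_recr /= -IH.
Qed.

Lemma Cc_norm_le (g : Cc R d) (e : R) : (forall x, `|g x| <= e) -> `|g| <= e.
Proof. exact: supnorm_le. Qed.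

End Cc_evaluation.

Section generator.
Variables (R : realType) (d : nat) (U : metricType R) (T m : R).
Variable f : 'rV[R]_d * U -> 'rV[R]_d.
Hypotheses (T0 : 0 < T) (U_compact : compact [set: U]) (f_continuous : continuous f).
Hypotheses (m0 : 0 < m) (f_growth : forall x u, `|f (x, u)| <= m * (1 + `|x|)).
Hypothesis f_lip : forall r : R, exists2 l, 0 < l &
  forall x y u, `|x| <= r -> `|y| <= r -> `|f (x, u) - f (y, u)| <= l * `|x - y|.
Variable tau : R.
Hypothesis tau0T : tau \in `[0, T].

Lemma continuous_controlled_field u : continuous (fun x => f (x, u)).
Proof.
move=> x; apply: (continuous_comp (f := fun y => (y, u)) (g := f)).
  apply: (@cvg_pair _ _ _ (nbhs x) (nbhs x) (nbhs u) _ _ _ id (cst u)).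
    exact: cvg_id.
  exact: cvg_cst.
exact: f_continuous.
Qed.

Lemma constant_control_flow u : exists Phi, controlled_flow T f (cst u) Phi.
Proof.
have lip r : exists2 l : R, 0 < l & forall x y : 'rV[R]_d, `|x| <= r -> `|y| <= r ->
    `|f (x, u) - f (y, u)| <= l * `|x - y|.
  by have [l l0 lP] := f_lip r; exists l => // x y; exact: lP.
have [Phi PhiE] := autonomous_flow T m0 (@continuous_controlled_field u)
  (fun x => f_growth x u) lip.
by exists Phi.
Qed.

Lemma constant_control_admissible u : admissible T (cst u : R -> U).
Proof.
move=> O _; have [Ou|nOu] := pselect (O u).
  rewrite (_ : _ `&` _ = `[0, T]%classic); first exact: itv_lebesgue_measurable.
  by apply/seteqP; split => [s []|s].
rewrite (_ : _ `&` _ = set0); first exact: measurable0.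
by apply/seteqP; split => [s [_ /nOu]|].
Qed.

Variable phi : Cc R d.
Hypothesis phi_C1 : C1c phi.

(** For [t] close to [tau] the support of [phi \o Phi tau t] is bounded by
    [flow_escape], so this function belongs to [Cc R d]. *)
Lemma Koopman_element u Phi t : admissible T u -> controlled_flow T f u Phi ->
  t \in `[0, T] -> `|t - tau| <= (2 * flow_speed T m 0)^-1 ->
  exists2 psi : Cc R d, (forall x, psi x = phi (Phi tau t x)) &
    Koopman T f tau t phi psi.
Proof.
move=> uA PhiE t0T tC; have [r r0 phir] := Cc_support_bounded phi.
have cPhi : continuous (fun x => phi (Phi tau t x)).
  have /cont_compact_supportP[cphi _] := valP phi.
  have [cP _] := PhiE tau t tau0T t0T.
  by move=> x; apply: continuous_comp; [exact: cP|exact: cphi].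
have mem : (fun x => phi (Phi tau t x)) \in @cont_compact_support R d.
  apply: (bounded_support_Cc (r := 2 * r + 1)) => // x rx; apply: phir.
  exact: (flow_escape m0 f_growth tau0T PhiE t0T tC rx).
by exists (MkCc mem) => //; exists u => //; exists Phi.
Qed.

Lemma lie_continuous u : continuous (lie f phi u).
Proof.
apply: continuous_big; first exact: add_continuous.
move=> i _ x; apply: (@cvgZ _ _ _ (nbhs x) _ (fun x => f (x, u) ord0 i)).
  apply: (continuous_comp (f := fun y => f (y, u)) (g := fun y => y ord0 i)).
    exact: continuous_controlled_field.
  exact: coord_continuous.
by case: phi_C1 => _ /(_ i); exact.
Qed.

Lemma lie_Cc : exists L : U -> Cc R d, forall u x, L u x = lie f phi u x.
Proof.
have [r r0 phir] := Cc_support_bounded phi.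
have mem u : lie f phi u \in @cont_compact_support R d.
  apply: (bounded_support_Cc (r := r)); first exact: lie_continuous.
  move=> x rx; rewrite /lie big1// => i _.
  by rewrite (partial_support phir)// scaler0.
by exists (fun u => MkCc (mem u)).
Qed.

Lemma lie_Cc_continuous (L : U -> Cc R d) :
  (forall u x, L u x = lie f phi u x) -> continuous L.
Proof.
move=> LE u; apply/cvgrPdist_le => e e0.
have [r r0 phir] := Cc_support_bounded phi.
have [G G0 GP] := partial_bounded phi_C1.
have dG0 : 0 < d%:R * G + 1 by rewrite ltr_wpDl ?mulr_ge0.
have e10 : 0 < e / (d%:R * G + 1) by rewrite divr_gt0.
have [delta d0 dP] := heine (compact_setX (closed_ball0_compact (r := r)) U_compact)
  f_continuous e10.
apply/nbhs_ballP; exists delta => // v uv /=; apply: Cc_norm_le => x.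
rewrite [X in `|X|](_ : _ = lie f phi u x - lie f phi v x); last by rewrite -!LE.
have [xr|rx] := leP `|x| r; last first.
  rewrite /lie !big1 ?subrr ?normr0 ?(ltW e0)// => i _;
    by rewrite (partial_support phir)// scaler0.
have fuv : `|f (x, u) - f (x, v)| <= e / (d%:R * G + 1).
  have : ball (f (x, u)) (e / (d%:R * G + 1)) (f (x, v)).
    by apply: dP; [split|split => //=; exact: ballxx].
  by rewrite -ball_normE; exact: ltW.
rewrite /lie -sumrB; apply: le_trans (ler_norm_sum _ _ _) _.
apply: (@le_trans _ _ (\sum_(i < d) (e / (d%:R * G + 1) * G))).
  apply: ler_sum => i _; rewrite -scalerBl normrZ; apply: ler_pM => //.
  apply: le_trans fuv; apply: le_trans (norm_coord_le _ i).
  by rewrite !mxE.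
rewrite sumr_const card_ord -[leLHS]mulr_natl.
rewrite (_ : _ * _ = e * (d%:R * G / (d%:R * G + 1))); last by ring.
by rewrite ler_piMr ?(ltW e0)// ler_pdivrMr// mul1r lerDl.
Qed.

Let quotient_estimate := koopman_quotient_estimate U_compact f_continuous m0
  f_growth tau0T phi_C1.

(** For the constant control the partition has a single piece, and the convex
    combination of [koopman_quotient_estimate] is the given Lie derivative. *)
Lemma Liouville_sub_liminf : Liouville f phi `<=`
  KP_liminf (punctured_at T tau) (Koopman_quotient T f tau phi).
Proof.
have PF := punctured_proper T0 tau0T.
move=> psi [u0 psiE]; apply: KP_liminf_approx => e e0.
have e2 : 0 < e / 2 by rewrite divr_gt0.
have [delta d0 [eta eta0 H]] := quotient_estimate e2.
have C0 : 0 < (2 * flow_speed T m 0)^-1.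
  by rewrite invr_gt0 mulr_gt0// flow_speed_gt0.
have [Phi PhiE] := constant_control_flow u0.
apply/punctured_atP; exists (Num.min eta (2 * flow_speed T m 0)^-1).
  by rewrite lt_min eta0.
move=> t t0T ttau; rewrite lt_min => /andP[teta tC].
have [xi xiE xiK] := Koopman_element (@constant_control_admissible u0) PhiE t0T (ltW tC).
exists ((t - tau)^-1 *: (xi - phi)); first by exists xi.
have Dn0 : `|t - tau| != 0 by rewrite normr_eq0 subr_eq0.
(* The single piece has index 0; the other indices carry the empty set. *)
pose A j : set R := if j == 0%N then hull tau t else set0.
have pA : partition_of 1 A (hull tau t).
  split.
  - by move=> [|j] /=; [exact: hull_measurable|exact: measurable0].
  - by move=> [|i] [|j] _ _ //= -[s []].
  - by rewrite big_ord1.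
have := H _ _ _ _ (fun=> u0) _ PhiE t0T ttau teta pA
  (fun _ _ _ _ => ballxx u0 d0).
have := mass_partition pA; rewrite big_ord1 => mE Hx.
apply: le_lt_trans (_ : e / 2 < e); last by rewrite ltr_pdivrMr// ltr_pMr// ltr1n.
rewrite distrC; apply: Cc_norm_le => x; have := Hx x.
by rewrite big_ord1 mE divff// scale1r -xiE -(psiE x : psi x = lie f phi u0 x).
Qed.

(** Every closed convex set that contains the Lie derivatives contains the convex
    combinations of [koopman_quotient_estimate], which approximate the quotients and
    hence the given limit point. *)
Lemma limsup_sub_hull :
  KP_limsup (punctured_at T tau) (Koopman_quotient T f tau phi) `<=`
  closed_convex_hull (Liouville f phi).
Proof.
have [L LE] := lie_Cc.
move=> psi psiK C [[C_closed C_convex] LC].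
apply: C_closed => B /nbhs_ballP[e /= e0 eB].
have e2 : 0 < e / 2 by rewrite divr_gt0.
have [delta d0 [eta eta0 H]] := quotient_estimate e2.
pose V : set R := [set t | [/\ t \in `[0, T], t != tau & `|t - tau| < eta]].
have FV : punctured_at T tau V by apply/punctured_atP; exists eta.
have [t [[t0T ttau teta] [_ [xi [u uA [Phi PhiE xiE]] <-] psixi]]] :=
  KP_limsup_approx psiK e2 FV.
have [n [v [A [pA Av]]]] := control_partition U_compact uA tau0T t0T d0.
have Dn0 : `|t - tau| != 0 by rewrite normr_eq0 subr_eq0.
exists (\sum_(j < n) (mass (A j) / `|t - tau|) *: L (v j)); split.
  apply: (convex_combination C_convex (c := fun j => mass (A j) / `|t - tau|)
    (a := fun j => L (v j))).
  - by move=> j; rewrite divr_ge0// mass_ge0.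
  - by move=> j; apply: LC; exists (v j) => x; rewrite LE.
  - by rewrite -mulr_suml (mass_partition pA) divff.
apply: eB; rewrite -ball_normE /=.
apply: le_lt_trans (ler_distD ((t - tau)^-1 *: (xi - phi)) _ _) _.
rewrite [ltRHS]splitr; apply: ltr_leD psixi _.
apply: Cc_norm_le => x; have := H _ _ _ _ v A PhiE t0T ttau teta pA Av x.
rewrite [X in _ -> `|X| <= _](_ : _ = (t - tau)^-1 *: (xi x - phi x) -
  (\sum_(j < n) (mass (A j) / `|t - tau|) *: L (v j)) x)//.
by rewrite Cc_sumE -xiE; under eq_bigr do rewrite -LE.
Qed.

(** The Liouville set is the image of the compact space [U] under a continuous map. *)
Lemma Liouville_closed : closed (Liouville f phi).
Proof.
have [L LE] := lie_Cc.
have -> : Liouville f phi = L @` [set: U].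
  apply/seteqP; split => [psi [u psiE]|_ [u _ <-]].
    by exists u => //; apply/val_inj/funext => x; exact: etrans (LE u x) (esym (psiE x)).
  by exists u => x; rewrite LE.
apply: compact_closed; first exact: norm_hausdorff.
apply: continuous_compact => //; apply: continuous_subspaceT.
exact: lie_Cc_continuous.
Qed.

Lemma Liouville_convex : convex_set (controlled_fields f) ->
  convex_set (Liouville f phi : set (convex_lmodType (Cc R d))).
Proof.
move=> cF psi1 psi2 k; rewrite !inE => -[u1 E1] [u2 E2].
have F1 : (fun x => f (x, u1)) \in controlled_fields f by rewrite inE; exists u1.
have F2 : (fun x => f (x, u2)) \in controlled_fields f by rewrite inE; exists u2.
have := cF _ _ k F1 F2; rewrite inE => -[w _ wE]; exists w => x.
have fE : f (x, w) = k%:num *: f (x, u1) + (1 - k%:num) *: f (x, u2).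
  exact: (congr1 (fun g => g x) wE).
transitivity (k%:num *: psi1 x + (1 - k%:num) *: psi2 x); first by [].
rewrite E1 E2 !scaler_sumr -big_split; apply: eq_bigr => i _ /=.
by rewrite fE !mxE [RHS]scalerDl !scalerA.
Qed.

Lemma Liouville_is_KP_lim : convex_set (controlled_fields f) ->
  is_KP_lim (punctured_at T tau) (Koopman_quotient T f tau phi) (Liouville f phi).
Proof.
move=> cF; have PF := punctured_proper T0 tau0T.
have hL : closed_convex_hull (Liouville f phi) `<=` Liouville f phi.
  apply: smallest_sub => //; split; first exact: Liouville_closed.
  exact: Liouville_convex.
have supL := subset_trans limsup_sub_hull hL.
have infsup := @KP_liminf_limsup _ _ _ (Koopman_quotient T f tau phi) PF.
split; apply/seteqP; split => //.
- exact: subset_trans infsup supL.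
- exact: Liouville_sub_liminf.
- exact: subset_trans Liouville_sub_liminf infsup.
Qed.

End generator.

Section euclidean_norm.
Variables (R : realType) (d : nat).
Implicit Types x : 'rV[R]_d.

Lemma norm_le_enorm x : `|x| <= enorm x.
Proof.
apply: norm_row_le => [|i]; first exact: sqrtr_ge0.
rewrite -sqrtr_sqr /enorm ler_wsqrtr// (bigD1 i)//= lerDl.
by apply: sumr_ge0 => j _; exact: sqr_ge0.
Qed.

Lemma enorm_le_norm x : enorm x <= d.+1%:R * `|x|.
Proof.
have h : 0 <= d.+1%:R * `|x| by rewrite mulr_ge0.
rewrite -[leRHS](ger0_norm h) -sqrtr_sqr /enorm ler_wsqrtr//.
apply: (@le_trans _ _ (\sum_(i < d) `|x| ^+ 2)).
  apply: ler_sum => i _; rewrite -real_normK ?num_real//.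
  by rewrite lerXn2r ?nnegrE// norm_coord_le.
rewrite sumr_const card_ord -[leLHS]mulr_natl exprMn ler_wpM2r ?sqr_ge0//.
by rewrite -natrX ler_nat (leq_trans (leqnSn d))// -{1}(expn1 d.+1) leq_pexp2l.
Qed.

End euclidean_norm.

Theorem theorem4p3 (R : realType) (d : nat) (U : metricType R) (T : R)
    (f : 'rV[R]_d * U -> 'rV[R]_d)
    (T_gt0 : 0 < T)
    (U_compact : compact [set: U])
    (f_continuous : continuous f)
    (f_growth : exists2 m : R, 0 < m &
       forall x u, enorm (f (x, u)) <= m * (1 + enorm x))
    (f_lipschitz : forall K : set 'rV[R]_d, compact K ->
       exists2 l : R, 0 < l &
         forall x y u, K x -> K y ->
           enorm (f (x, u) - f (y, u)) <= l * enorm (x - y))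
    (tau : R) (tau0T : tau \in `[0, T]) :
  (forall phi : Cc R d, C1c phi ->
     Liouville f phi `<=`
       KP_liminf (punctured_at T tau) (Koopman_quotient T f tau phi) /\
     KP_limsup (punctured_at T tau) (Koopman_quotient T f tau phi) `<=`
       closed_convex_hull (Liouville f phi)) /\
  (convex_set (controlled_fields f) ->
   forall phi : Cc R d, C1c phi ->
     is_KP_lim (punctured_at T tau) (Koopman_quotient T f tau phi)
       (Liouville f phi)).
Proof.
have [m m0 f_enorm] := f_growth.
have m0' : 0 < m * d.+1%:R by rewrite mulr_gt0.
have f_norm x u : `|f (x, u)| <= m * d.+1%:R * (1 + `|x|).
  apply: le_trans (norm_le_enorm _) _; apply: le_trans (f_enorm x u) _.
  rewrite -mulrA ler_pM2l// mulrDr mulr1 lerD ?enorm_le_norm//.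
  by rewrite ler1n.
have f_lip (r : R) : exists2 l : R, 0 < l & forall x y u, `|x| <= r -> `|y| <= r ->
    `|f (x, u) - f (y, u)| <= l * `|x - y|.
  have [l l0 lP] := f_lipschitz _ (closed_ball0_compact (d := d) (r := r)).
  exists (l * d.+1%:R); first by rewrite mulr_gt0.
  move=> x y u xr yr; apply: le_trans (norm_le_enorm _) _.
  by apply: le_trans (lP x y u xr yr) _; rewrite -mulrA ler_pM2l// enorm_le_norm.
split=> [phi phi_C1|f_convex phi phi_C1].
  split; first exact: (Liouville_sub_liminf T_gt0 U_compact f_continuous m0' f_norm).
  exact: (limsup_sub_hull U_compact f_continuous m0' f_norm).
exact: (Liouville_is_KP_lim T_gt0 U_compact f_continuous m0' f_norm).
Qed.
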